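(* Let $R=\bigoplus_{k\in\mathbb{Z}}R_k$ be a strongly $\mathbb{Z}$-graded ring, let $P=\bigoplus_{k\ge0}R_k$, and let $C^{+}$ be a bounded chain complex of finitely generated free $P$-modules. The following statements are equivalent: (1) The chain complex $C^{+}$ is $R_0$-finitely dominated. (2) The induced chain complex $C^{+}\otimes_P\Omega_+^{-1}P$ is contractible. (3) The induced chain complex $C^{+}\otimes_P\Omega_+^{-1}R$ is contractible.
   Context: All rings are unital (possibly non-commutative), ring homomorphisms preserve $1$, modules are right modules. A $\mathbb{Z}$-graded ring $R$ is strongly graded if the multiplication map $R_n\otimes_{R_0}R_{-n}\to R_0$ is surjective for every $n\in\mathbb{Z}$. $P=\bigoplus_{k\ge0}R_k$ is a subring of $R$. For $m\in\mathbb{Z}$ put $t^{-m}P=\bigoplus_{k\ge-m}R_k\subseteq R$, a $P$-bimodule (finitely generated projective as a right $P$-module when $R$ is strongly graded). A chain complex of $R_0$-modules (a complex of $P$-modules is regarded as one by restriction of scalars) is $R_0$-finitely dominated if it is a retract up to chain homotopy of a bounded complex of finitely generated free $R_0$-modules. Let $R_*((t^{-1}))$ be the ring of formal Laurent series $\sum_{k\le p}r_kt^k$ ($p\in\mathbb{Z}$) with $r_k\in R_k$ for all $k$ ($t$ central); $R$ is the subring of finite sums (identify $r\in R_k$ with $rt^k$). $\Omega_+$ is the set of all square matrices $A$ (of arbitrary finite size) with entries in $R$ that are invertible as matrices over $R_*((t^{-1}))$. For $A\in\Omega_+$ of size $k$ call $m\in\mathbb{Z}$ suitable if all entries of $A$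 lie in $t^{-m}P$; then $\mu(A,m)\colon P^k\to(t^{-m}P)^k$, $x\mapsto A\cdot x$, is a homomorphism of right $P$-modules. Non-commutative localisation: for a ring $K$ and a set $\Sigma$ of homomorphisms of finitely generated projective right $K$-modules, $K\to\Sigma^{-1}K$ is the initial ring homomorphism with domain $K$ such that $\sigma\otimes_K\Sigma^{-1}K$ is an isomorphism for all $\sigma\in\Sigma$. $\Omega_+^{-1}P$ denotes the localisation of $P$ inverting all the maps $\mu(A,m)$ ($A\in\Omega_+$, $m$ suitable for $A$). $\Omega_+^{-1}R$ denotes the localisation of $R$ inverting all the maps $R^k\to R^k$, $x\mapsto A\cdot x$ ($A\in\Omega_+$ of size $k$, $k\ge1$). *)

(* Defs.v *)
From HB Require Import structures.
From mathcomp Require Import all_boot all_order all_algebra generic_quotient zify.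
From mathcomp Require Import finmap boolp classical_sets functions cardinality.
From mathcomp Require Import fsbigop.
Set Implicit Arguments.
Unset Strict Implicit.
Unset Printing Implicit Defensive.
Import Order.TTheory GRing.Theory Num.Theory.
Local Open Scope classical_set_scope.
Local Open Scope ring_scope.
Local Open Scope quotient_scope.

(* Rings are pzRingTypes, so the zero ring is allowed: a universal localisation
   may vanish. *)

(* A right K-module is a left module over the converse ring K^c: the product
   m.a is written (a : K^c) *: m. *)
Notation rmodType K := (lmodType K^c).

Definition balanced (K : pzRingType) (M : rmodType K) (N : lmodType K)
    (W : zmodType) (b : M -> N -> W) : Prop :=
  [/\ forall m m' n, b (m + m') n = b m n + b m' n,
      forall m n n', b m (n + n') = b m n + b m n'
    & forall m (a : K) n, b ((a : K^c) *: m) n = b m (a *: n)].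

Section Tensor.
Variables (K : pzRingType) (M : rmodType K) (N : lmodType K).
Implicit Types (W : zmodType) (s t u : seq (M * N)).

Definition eval_sum W (b : M -> N -> W) s : W := \sum_(p <- s) b p.1 p.2.

(* M (x)_K N is the set of formal sums of pairs (m, n) modulo the least
   congruence making (m, n) |-> m (x) n balanced. That congruence identifies two
   sums exactly when no balanced map into an abelian group separates them, which
   is the form used here; tens_universal states the universal property. *)
Definition tens_rel s t : bool :=
  `[< forall W (b : M -> N -> W), balanced b -> eval_sum b s = eval_sum b t >].

Lemma tens_rel_equiv : equiv_class_of tens_rel.
Proof.
split.
- by move=> s; apply/asboolP.
- by move=> s t; apply/asboolP/asboolP => h W b hb; rewrite h.
- by move=> s t u /asboolP h1 /asboolP h2; apply/asboolP => W b hb; rewrite h1 // h2.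
Qed.
Canonical tens_equiv_rel := EquivRelPack tens_rel_equiv.

Definition tens : Type := {eq_quot tens_rel}.
HB.instance Definition _ := Choice.on tens.
HB.instance Definition _ := EqQuotient.on tens.

Definition tcls s : tens := \pi_tens s.
Definition tpure (m : M) (n : N) : tens := tcls [:: (m, n)].

Lemma tclsP s t : tcls s = tcls t <-> forall W (b : M -> N -> W), balanced b ->
   eval_sum b s = eval_sum b t.
Proof.
split=> [/eqP | h]; last first.
  by apply/eqP; rewrite /tcls eqmodE; apply/asboolP.
by rewrite /tcls eqmodE => /asboolP.
Qed.

Lemma tcls_repr x : tcls (repr x) = x. Proof. exact: reprK. Qed.

Lemma eval_repr W (b : M -> N -> W) s :
  balanced b -> eval_sum b (repr (tcls s)) = eval_sum b s.
Proof. by move=> hb; have /tclsP := tcls_repr (tcls s); apply. Qed.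

Lemma eval_cat W (b : M -> N -> W) s t :
  eval_sum b (s ++ t) = eval_sum b s + eval_sum b t.
Proof. exact: big_cat. Qed.

Definition tneg s := [seq (- p.1, p.2) | p <- s].

Lemma balanced0 W (b : M -> N -> W) n : balanced b -> b 0 n = 0.
Proof. by case=> hD _ _; apply: (addrI (b 0 n)); rewrite -hD !addr0. Qed.

Lemma eval_neg W (b : M -> N -> W) s : 
  balanced b -> eval_sum b (tneg s) = - eval_sum b s.
Proof.
move=> hb; rewrite /eval_sum big_map /= -sumrN; apply: eq_bigr => -[m n] _ /=.
by apply/eqP; rewrite -addr_eq0; case: (hb) => <- _ _; rewrite addNr balanced0.
Qed.

Definition tadd (x y : tens) : tens := tcls (repr x ++ repr y).
Definition topp (x : tens) : tens := tcls (tneg (repr x)).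

Lemma taddE s t : tadd (tcls s) (tcls t) = tcls (s ++ t).
Proof. by apply/tclsP => W b hb; rewrite !eval_cat !eval_repr. Qed.
Lemma toppE s : topp (tcls s) = tcls (tneg s).
Proof. by apply/tclsP => W b hb; rewrite !eval_neg // !eval_repr. Qed.

Lemma tensP (Q : tens -> Prop) : (forall s, Q (tcls s)) -> forall x, Q x.
Proof. by move=> h x; rewrite -[x]tcls_repr. Qed.

Fact taddA : associative tadd.
Proof.
elim/tensP=> s; elim/tensP=> t; elim/tensP=> u; rewrite !taddE.
by apply/tclsP => W b hb; rewrite !eval_cat addrA.
Qed.
Fact taddC : commutative tadd.
Proof.
elim/tensP=> s; elim/tensP=> t; rewrite !taddE.
by apply/tclsP => W b hb; rewrite !eval_cat addrC.
Qed.
Fact tadd0 : left_id (tcls [::]) tadd.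
Proof. by elim/tensP=> s; rewrite !taddE. Qed.
Fact taddN : left_inverse (tcls [::]) topp tadd.
Proof.
elim/tensP=> s; rewrite toppE taddE; apply/tclsP => W b hb.
by rewrite eval_cat eval_neg // addNr /eval_sum big_nil.
Qed.
HB.instance Definition _ := GRing.isZmodule.Build tens taddA taddC tadd0 taddN.

Lemma tcls_cat s t : tcls (s ++ t) = tcls s + tcls t.
Proof. by rewrite -taddE. Qed.

Lemma tcls_sum s : tcls s = \sum_(p <- s) tpure p.1 p.2.
Proof.
elim: s => [|[m n] s IHs]; first by rewrite big_nil.
by rewrite big_cons -IHs -cat1s tcls_cat.
Qed.

Lemma tpure_balanced : balanced tpure.
Proof.
split=> [m m' n|m n n'|m a n].
- rewrite -tcls_cat; apply/tclsP => W b [hD _ _].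
  by rewrite eval_cat /eval_sum !big_seq1 /= hD.
- rewrite -tcls_cat; apply/tclsP => W b [_ hD _].
  by rewrite eval_cat /eval_sum !big_seq1 /= hD.
- by apply/tclsP => W b [_ _ hZ]; rewrite /eval_sum !big_seq1 /= hZ.
Qed.

Definition tlift W (b : M -> N -> W) (x : tens) : W := eval_sum b (repr x).

Lemma tlift_cls W (b : M -> N -> W) s : balanced b -> tlift b (tcls s) = eval_sum b s.
Proof. exact: eval_repr. Qed.

Lemma tlift_pure W (b : M -> N -> W) m n : balanced b -> tlift b (tpure m n) = b m n.
Proof. by move=> hb; rewrite tlift_cls // /eval_sum big_seq1. Qed.

Lemma tliftD W (b : M -> N -> W) : balanced b -> {morph tlift b : x y / x + y}.
Proof.
move=> hb; elim/tensP=> s; elim/tensP=> t.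
by rewrite -tcls_cat !tlift_cls // eval_cat.
Qed.

Lemma tens_universal W (b : M -> N -> W) : balanced b ->
  exists! g : tens -> W,
    {morph g : x y / x + y} /\ forall m n, g (tpure m n) = b m n.
Proof.
move=> hb; exists (tlift b); split.
  by split=> [|m n]; [exact: tliftD | exact: tlift_pure].
move=> g [gD gE]; apply/funext; elim/tensP => s; rewrite tlift_cls //.
have g0 : g 0 = 0 by apply: (addrI (g 0)); rewrite -gD !addr0.
rewrite tcls_sum /eval_sum (big_morph g gD g0).
by apply: eq_bigr => p _; rewrite gE.
Qed.

Lemma tens_ind (Q : tens -> Prop) :
  Q 0 -> (forall m n x, Q x -> Q (tpure m n + x)) -> forall x, Q x.
Proof.
move=> h0 hD; elim/tensP; elim=> [//|[m n] s IHs].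
by rewrite -cat1s tcls_cat; apply: hD.
Qed.
End Tensor.

(* Aliases of the carrier bearing the K-module structure pulled back along f. *)
Definition lrestr (K S : pzRingType) (f : {rmorphism K -> S}) (N : lmodType S)
  : Type := N.
Definition rrestr (K S : pzRingType) (f : {rmorphism K -> S}) (M : rmodType S)
  : Type := M.

Section Restriction.
Variables (K S : pzRingType) (f : {rmorphism K -> S}).

Section Left.
Variable N : lmodType S.
HB.instance Definition _ := GRing.Zmodule.on (lrestr f N).
Definition lrestr_scale (a : K) (n : lrestr f N) : lrestr f N := f a *: (n : N).
Fact lrestr_scaleA a b n :
  lrestr_scale a (lrestr_scale b n) = lrestr_scale (a * b) n.
Proof. by rewrite /lrestr_scale scalerA rmorphM. Qed.
Fact lrestr_scale1 : left_id 1 lrestr_scale.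
Proof. by move=> n; rewrite /lrestr_scale rmorph1 scale1r. Qed.
Fact lrestr_scaleDr : right_distributive lrestr_scale +%R.
Proof. by move=> a m n; rewrite /lrestr_scale scalerDr. Qed.
Fact lrestr_scaleDl n : {morph lrestr_scale^~ n : a b / a + b}.
Proof. by move=> a b; rewrite /lrestr_scale rmorphD scalerDl. Qed.
HB.instance Definition _ := GRing.Zmodule_isLmodule.Build K (lrestr f N)
  lrestr_scaleA lrestr_scale1 lrestr_scaleDr lrestr_scaleDl.
End Left.

Section Right.
Variable M : rmodType S.
HB.instance Definition _ := GRing.Zmodule.on (rrestr f M).
Definition rrestr_scale (a : K^c) (m : rrestr f M) : rrestr f M :=
  (f a : S^c) *: (m : M).
Fact rrestr_scaleA a b m :
  rrestr_scale a (rrestr_scale b m) = rrestr_scale (a * b) m.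
Proof. by rewrite /rrestr_scale scalerA; congr (_ *: _); exact: esym (rmorphM f b a). Qed.
Fact rrestr_scale1 : left_id 1 rrestr_scale.
Proof. by move=> m; rewrite /rrestr_scale rmorph1 scale1r. Qed.
Fact rrestr_scaleDr : right_distributive rrestr_scale +%R.
Proof. by move=> a m n; rewrite /rrestr_scale scalerDr. Qed.
Fact rrestr_scaleDl m : {morph rrestr_scale^~ m : a b / a + b}.
Proof.
move=> a b; rewrite /rrestr_scale -scalerDl.
exact: (congr1 (fun c : S^c => c *: (m : M)) (rmorphD f a b)).
Qed.
HB.instance Definition _ := GRing.Zmodule_isLmodule.Build K^c (rrestr f M)
  rrestr_scaleA rrestr_scale1 rrestr_scaleDr rrestr_scaleDl.
End Right.
Definition rrestr_map (M N : rmodType S) (g : {linear M -> N}) :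
   rrestr f M -> rrestr f N := g.
Fact rrestr_map_linear (M N : rmodType S) (g : {linear M -> N}) : linear (rrestr_map g).
Proof. by move=> a m n; rewrite [LHS]linearP. Qed.
HB.instance Definition _ (M N : rmodType S) (g : {linear M -> N}) :=
  GRing.isLinear.Build K^c (rrestr f M) (rrestr f N) _ (@rrestr_map M N g)
    (@rrestr_map_linear M N g).
End Restriction.
Arguments rrestr_map {K S} f {M N} g.

(* M (x)_K S, a right S-module by (m (x) s).a = m (x) (s * a). *)
Definition ext_mod (K S : pzRingType) (f : {rmorphism K -> S}) (M : rmodType K) : Type
  := tens M (lrestr f S^o).

Section Extension.
Variables (K S : pzRingType) (f : {rmorphism K -> S}).

Section Obj.
Variable M : rmodType K.
Local Notation Sl := (lrestr f S^o).
HB.instance Definition _ := GRing.Zmodule.on (ext_mod f M).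
Definition ext_bil (a : S^c) (m : M) (s : Sl) : ext_mod f M :=
  tpure m ((s : S) * (a : S) : Sl).
Fact ext_bil_balanced a : balanced (ext_bil a).
Proof.
have [hl hr hz] := @tpure_balanced K M Sl.
split=> [m m' s|m s s'|m b s]; rewrite /ext_bil ?hl //.
- by rewrite -hr; congr tpure; exact: mulrDl.
- by rewrite hz; congr tpure; exact: mulrA.
Qed.
Definition ext_scale (a : S^c) (x : ext_mod f M) : ext_mod f M := tlift (ext_bil a) x.
Fact ext_scale_pure a (m : M) (s : S) :
  ext_scale a (tpure m (s : Sl)) = tpure m (s * (a : S) : Sl).
Proof. exact/tlift_pure/ext_bil_balanced. Qed.
Fact ext_scaleDr : right_distributive ext_scale +%R.
Proof. by move=> a; apply/tliftD/ext_bil_balanced. Qed.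
Fact ext_scale0 a : ext_scale a 0 = 0.
Proof. by apply: (addrI (ext_scale a 0)); rewrite -ext_scaleDr !addr0. Qed.
Fact ext_scaleA a b x : ext_scale a (ext_scale b x) = ext_scale (a * b) x.
Proof.
elim/tens_ind: x => [|m s x IHx]; first by rewrite !ext_scale0.
rewrite !ext_scaleDr IHx; congr (_ + _); rewrite !ext_scale_pure.
by congr tpure; rewrite -[LHS]mulrA.
Qed.
Fact ext_scale1 : left_id 1 ext_scale.
Proof.
elim/tens_ind=> [|m s x IHx]; first by rewrite !ext_scale0.
by rewrite !ext_scaleDr IHx ext_scale_pure mulr1.
Qed.
Fact ext_scaleDl x : {morph ext_scale^~ x : a b / a + b}.
Proof.
move=> a b; elim/tens_ind: x => [|m s x IHx]; first by rewrite !ext_scale0 addr0.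
rewrite !ext_scaleDr IHx !ext_scale_pure addrACA; congr (_ + _).
have [_ hr _] := @tpure_balanced K M Sl.
by rewrite -hr; congr tpure; exact: mulrDr.
Qed.
HB.instance Definition _ := GRing.Zmodule_isLmodule.Build S^c (ext_mod f M)
  ext_scaleA ext_scale1 ext_scaleDr ext_scaleDl.
Lemma ext_pureZ (a : S) (m : M) (s : S) :
  (a : S^c) *: (tpure m (s : Sl) : ext_mod f M) = tpure m (s * a : Sl).
Proof. exact: ext_scale_pure. Qed.
End Obj.

Definition ext_map (M N : rmodType K) (g : {linear M -> N}) : ext_mod f M -> ext_mod f N :=
  tlift (fun m (s : lrestr f S^o) => tpure (g m) s).

Fact ext_map_balanced (M N : rmodType K) (g : {linear M -> N}) :
  balanced (fun m (s : lrestr f S^o) => tpure (g m) s).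
Proof.
have [hl hr hz] := @tpure_balanced K N (lrestr f S^o).
by split=> *; rewrite ?linearD ?linearZ ?(hl, hr, hz).
Qed.

Lemma ext_map_pure (M N : rmodType K) (g : {linear M -> N}) m (s : lrestr f S^o) :
  ext_map g (tpure m s) = tpure (g m) s.
Proof. exact/tlift_pure/ext_map_balanced. Qed.

Fact ext_mapD (M N : rmodType K) (g : {linear M -> N}) : {morph ext_map g : x y / x + y}.
Proof. exact/tliftD/ext_map_balanced. Qed.
Fact ext_map0 (M N : rmodType K) (g : {linear M -> N}) : ext_map g 0 = 0.
Proof. by apply: (addrI (ext_map g 0)); rewrite -ext_mapD !addr0. Qed.

Fact ext_map_linear (M N : rmodType K) (g : {linear M -> N}) : linear (ext_map g).
Proof.
move=> a x y; rewrite ext_mapD; congr (_ + _).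
elim/tens_ind: x => [|m s x IHx]; first by rewrite scaler0 ext_map0 scaler0.
rewrite scalerDr ext_mapD IHx ext_mapD scalerDr; congr (_ + _).
by rewrite ext_map_pure !ext_pureZ ext_map_pure.
Qed.
HB.instance Definition _ (M N : rmodType K) (g : {linear M -> N}) :=
  GRing.isLinear.Build S^c (ext_mod f M) (ext_mod f N) _ (@ext_map M N g)
    (@ext_map_linear M N g).
End Extension.
Arguments ext_map {K S} f {M N} g.

(* Complexes are indexed by int; the differential starting in degree n + 1 is
   bd n, so no degree casts are needed, and every degree has the form n + 1. *)
Record chain_complex (K : pzRingType) := ChainComplex {
  obj :> int -> rmodType K;
  bd : forall n, {linear obj (n + 1) -> obj n};
  bdK : forall n (x : obj (n + 1 + 1)), bd n (bd (n + 1) x) = 0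
}.

Section Complexes.
Variable K : pzRingType.
Implicit Types (C D : chain_complex K) (M : rmodType K).

Definition bounded_complex C : Prop :=
  exists N : nat, forall n, N%:Z < `|n| -> forall x : C n, x = 0.

Definition fg_free M : Prop :=
  exists n (g : {linear {ffun 'I_n -> K^c^o} -> M}), bijective g.

Definition chain_map C D (f : forall n, {linear C n -> D n}) : Prop :=
  forall n (x : C (n + 1)), f n (bd C n x) = bd D n (f (n + 1) x).

Definition homotopic C D (f g : forall n, {linear C n -> D n}) : Prop :=
  exists h : forall n, {linear C n -> D (n + 1)},
    forall n (x : C (n + 1)), f (n + 1) x - g (n + 1) x =
      bd D (n + 1) (h (n + 1) x) + h n (bd C n x).

Definition contractible C : Prop :=
  @homotopic C C (fun n => idfun) (fun n => \0).

Definition finitely_dominated C : Prop :=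
  exists D, [/\ bounded_complex D, forall n, fg_free (D n)
    & exists (i : forall n, {linear C n -> D n}) (r : forall n, {linear D n -> C n}),
      [/\ chain_map i, chain_map r
        & @homotopic C C (fun n => r n \o i n) (fun n => idfun)]].
End Complexes.

Section ChangeOfRings.
Variables (K S : pzRingType) (f : {rmorphism K -> S}).

Section Restrict.
Variable C : chain_complex S.
Definition restrict_bd n : {linear rrestr f (C (n + 1)) -> rrestr f (C n)} :=
  rrestr_map f (bd C n).
Fact restrict_bdK n x : restrict_bd n (restrict_bd (n + 1) x) = 0.
Proof. exact: bdK. Qed.
Definition restrict_scalars : chain_complex K := ChainComplex restrict_bdK.
End Restrict.

Section Extend.
Variable C : chain_complex K.
Definition extend_bd n : {linear ext_mod f (C (n + 1)) -> ext_mod f (C n)} :=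
  ext_map f (bd C n).
Fact extend_bdK n x : extend_bd n (extend_bd (n + 1) x) = 0.
Proof.
elim/tens_ind: x => [|m s x IHx]; first by rewrite !linear0.
rewrite !linearD IHx addr0 /= !ext_map_pure bdK.
exact: balanced0 (tpure_balanced _ _).
Qed.
Definition extend_scalars : chain_complex S := ChainComplex extend_bdK.
End Extend.
End ChangeOfRings.

(* A class of homomorphisms of right K-modules, used here for the sets of maps
   between finitely generated projective modules that are to be inverted. *)
Definition hom_class (K : pzRingType) :=
  forall M N : rmodType K, {linear M -> N} -> Prop.

Definition inverts (K S : pzRingType) (f : {rmorphism K -> S})
    (Sigma : hom_class K) : Prop :=
  forall (M N : rmodType K) (s : {linear M -> N}), Sigma M N s ->
    bijective (ext_map f s).

Definition universal_localisation (K L : pzRingType) (f : {rmorphism K -> L})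
    (Sigma : hom_class K) : Prop :=
  inverts f Sigma /\
  forall (S : pzRingType) (g : {rmorphism K -> S}), inverts g Sigma ->
    exists h : {rmorphism L -> S}, (forall x, h (f x) = g x) /\
      forall h' : {rmorphism L -> S}, (forall x, h' (f x) = g x) -> h' =1 h.

Lemma sum_allE (I : choiceType) (V : zmodType) (s : seq I) (F : I -> V) :
  uniq s -> (forall k, k \notin s -> F k = 0) ->
  \sum_(k \in [set: I]) F k = \sum_(k <- s) F k.
Proof.
move=> us h; rewrite (fsbigTE [fset k in s]%fset); last first.
  by move=> k; rewrite inE; apply: h.
by apply/perm_big/uniq_perm => // k; rewrite inE.
Qed.

Lemma sum_all_shift (V : zmodType) (F : int -> V) i :
  \sum_(k \in [set: int]) F (k - i) = \sum_(k \in [set: int]) F k.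
Proof.
rewrite [RHS](reindex_fsbigT (fun k => k - i)) //.
by exists (fun k => k + i) => k; rewrite ?addrK ?subrK.
Qed.

Lemma fin_suppP (V : zmodType) (F : int -> V) :
  finite_set [set k | F k != 0] ->
  exists2 s : seq int, uniq s & forall k, k \notin s -> F k = 0.
Proof.
move=> /finite_seqP[s hs]; exists (undup s) => [|k]; first exact: undup_uniq.
rewrite mem_undup => hk; apply/eqP; apply: contraNT hk => hk.
by have : [set` s] k by rewrite -hs.
Qed.

Lemma fin_supp_seq (V : zmodType) (F : int -> V) (s : seq int) :
  (forall k, k \notin s -> F k = 0) -> finite_set [set k | F k != 0].
Proof.
move=> h; apply: (@sub_finite_set _ _ [set` s]); last exact: finite_seq.
by move=> k /= hk; apply: contraNT hk => /h/eqP.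
Qed.

Definition zrange (a b : int) : seq int :=
  if a <= b then [seq a + i%:Z | i <- iota 0 `|b - a|.+1] else [::].

Lemma mem_zrange a b k : (k \in zrange a b) = (a <= k <= b).
Proof.
rewrite /zrange; case: ifP => hab; last by rewrite in_nil; lia.
apply/mapP/idP => [[i]|hk]; first by rewrite mem_iota => hi ->; lia.
by exists `|k - a|%N; rewrite ?mem_iota; lia.
Qed.

Lemma zrange_uniq a b : uniq (zrange a b).
Proof.
by rewrite /zrange; case: ifP => // _; rewrite map_inj_uniq ?iota_uniq // => i j; lia.
Qed.

(* Internal direct sum decomposition of the additive group of R into the
   subgroups homog k = R_k. *)
Record zgrading (R : pzRingType) := ZGrading {
  homog :> int -> zmodClosed R;
  homog1 : 1 \in homog 0;
  homogM : forall i j x y,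
    x \in homog i -> y \in homog j -> x * y \in homog (i + j);
  homog_direct : forall x, exists! c : int -> R,
    [/\ forall k, c k \in homog k, finite_set [set k | c k != 0]
      & x = \sum_(k \in [set: int]) c k]
}.

Section Grading.
Variables (R : pzRingType) (G : zgrading R).

(* hcoef x k is the component of x in degree k. *)
Definition hcoef (x : R) : int -> R := projT1 (cid (homog_direct G x)).

Lemma hcoefP x : [/\ forall k, hcoef x k \in G k,
  finite_set [set k | hcoef x k != 0] & x = \sum_(k \in [set: int]) hcoef x k].
Proof. by rewrite /hcoef; case: cid => c []. Qed.

Lemma hcoef_homog x k : hcoef x k \in G k. Proof. by case: (hcoefP x). Qed.

Lemma homogM_sub i n x y : x \in G i -> y \in G (n - i) -> x * y \in G n.
Proof. by move=> hx /(homogM hx); rewrite addrC subrK. Qed.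

Lemma hcoef_unique x (c : int -> R) (s : seq int) :
  (forall k, c k \in G k) -> uniq s -> (forall k, k \notin s -> c k = 0) ->
  x = \sum_(k <- s) c k -> hcoef x = c.
Proof.
move=> hc us hs hx; rewrite /hcoef; case: cid => c' [_ huniq] /=; apply: huniq.
by split=> //; [exact: fin_supp_seq hs | rewrite hx (sum_allE us hs)].
Qed.

Lemma hcoef_seq x : exists s : seq int,
  [/\ uniq s, forall k, k \notin s -> hcoef x k = 0 & x = \sum_(k <- s) hcoef x k].
Proof.
have [_ /fin_suppP[s us hs] hx] := hcoefP x; exists s.
by rewrite -(sum_allE us hs).
Qed.

Lemma hcoef_id i (x : R) : x \in G i -> hcoef x = fun k => if k == i then x else 0.
Proof.
move=> hx; apply: (@hcoef_unique x _ [:: i]) => //.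
- by move=> k; case: eqP => [->|_]; rewrite ?rpred0.
- by move=> k; rewrite inE => /negPf->.
- by rewrite big_seq1 eqxx.
Qed.

Lemma hcoefB (x y : R) : hcoef (x - y) = hcoef x - hcoef y.
Proof.
have [s [us hs hx]] := hcoef_seq x; have [t [ut ht hy]] := hcoef_seq y.
have hu k : k \notin undup (s ++ t) -> hcoef x k = 0 /\ hcoef y k = 0.
  by rewrite mem_undup mem_cat negb_or => /andP[/hs-> /ht->].
apply: (@hcoef_unique _ _ (undup (s ++ t))) => [k||k /hu[hxk hyk]|].
- by rewrite !fctE; apply: rpredB; apply: hcoef_homog.
- exact: undup_uniq.
- by rewrite !fctE hxk hyk subr0.
rewrite sumrB; congr (_ - _).
  rewrite -(sum_allE (undup_uniq _)); last by move=> k /hu[].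
  by rewrite (sum_allE us hs).
rewrite -(sum_allE (undup_uniq _)); last by move=> k /hu[].
by rewrite (sum_allE ut ht).
Qed.

Lemma hcoef0 : hcoef 0 = 0.
Proof. by rewrite -(subrr 0) hcoefB subrr. Qed.

Definition hconv (f g : int -> R) (n : int) : R :=
  \sum_(i \in [set: int]) f i * g (n - i).

Lemma hcoefM (x y : R) : hcoef (x * y) = hconv (hcoef x) (hcoef y).
Proof.
have [s [us hs hx]] := hcoef_seq x; have [t [ut ht hy]] := hcoef_seq y.
pose u := undup [seq i + j | i <- s, j <- t].
have hus i j : i \in s -> j \notin u -> hcoef y (j - i) = 0.
  move=> hi; rewrite mem_undup => hj; apply: ht; apply: contra hj => hji.
  by apply/allpairsP; exists (i, j - i); split=> //=; rewrite addrC subrK.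
have convE n : hconv (hcoef x) (hcoef y) n = \sum_(i <- s) hcoef x i * hcoef y (n - i).
  by apply: sum_allE => // k /hs->; rewrite mul0r.
apply: (@hcoef_unique _ _ u) => [k||k hk|].
- rewrite convE; apply: rpred_sum => i _.
  by apply: homogM_sub; apply: hcoef_homog.
- exact: undup_uniq.
- by rewrite convE big_seq big1 // => i /hus->; rewrite ?mulr0.
under [RHS]eq_bigr do rewrite convE.
rewrite exchange_big /= [in LHS]hx mulr_suml big_seq [RHS]big_seq.
apply: eq_bigr => i hi; rewrite -mulr_sumr; congr (_ * _).
rewrite -(sum_allE (undup_uniq _)); last by move=> j; apply: hus.
rewrite (sum_all_shift (hcoef y)) (sum_allE ut ht) -hy //.
Qed.

(* The sum of the R_k with k >= j. In particular P = from_deg 0 and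
   t^-m P = from_deg (- m). *)
Definition from_deg (j : int) : {pred R} :=
  fun x => `[< forall k, k < j -> hcoef x k = 0 >].

Lemma from_degP j x : reflect (forall k, k < j -> hcoef x k = 0) (x \in from_deg j).
Proof. exact: asboolP. Qed.

Fact from_deg_zmod_closed j : zmod_closed (from_deg j).
Proof.
split=> [|x y /from_degP hx /from_degP hy]; apply/from_degP => k hk.
  by rewrite hcoef0.
by rewrite hcoefB !fctE hx ?hy ?subr0.
Qed.
HB.instance Definition _ j := GRing.isZmodClosed.Build R (from_deg j)
  (from_deg_zmod_closed j).

Lemma from_degM i j (x y : R) : x \in from_deg i -> y \in from_deg j -> x * y \in from_deg (i + j).
Proof.
move=> /from_degP hx /from_degP hy; apply/from_degP => k hk; rewrite hcoefM.
apply: fsbig1 => l _; case: (ltP l i) => hl; first by rewrite hx ?mul0r.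
by rewrite hy ?mulr0 //; lia.
Qed.

Lemma homog_from_deg i (x : R) : x \in G i -> x \in from_deg i.
Proof.
by move=> /hcoef_id hx; apply/from_degP => k hk; rewrite hx lt_eqF.
Qed.

Fact from_deg0_subring_closed : subring_closed (from_deg 0).
Proof.
split=> [|x y|x y]; first exact/homog_from_deg/homog1.
  exact: rpredB.
exact: from_degM.
Qed.

Fact homog0_subring_closed : subring_closed (G 0).
Proof.
split=> [|x y|x y]; [exact: homog1 | exact: rpredB |].
by rewrite -{3}(addr0 0); apply: homogM.
Qed.

(* The rings R_0 (deg0) and P (nonneg). *)
Record deg0 := Deg0 { deg0_val : R; _ : deg0_val \in G 0 }.
HB.instance Definition _ := [isSub for deg0_val].
HB.instance Definition _ := [Choice of deg0 by <:].
HB.instance Definition _ := GRing.SubChoice_isSubPzRing.Build R _ deg0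
  homog0_subring_closed.
HB.instance Definition _ := GRing.RMorphism.copy deg0_val (val : deg0 -> R).

Record nonneg := Nonneg { nonneg_val : R; _ : nonneg_val \in from_deg 0 }.
HB.instance Definition _ := [isSub for nonneg_val].
HB.instance Definition _ := [Choice of nonneg by <:].
HB.instance Definition _ := GRing.SubChoice_isSubPzRing.Build R (from_deg 0) nonneg
  from_deg0_subring_closed.
HB.instance Definition _ := GRing.RMorphism.copy nonneg_val (val : nonneg -> R).

Definition deg0_nonneg (a : deg0) : nonneg := Nonneg (homog_from_deg (valP a)).
Fact deg0_nonneg_zmod : zmod_morphism deg0_nonneg.
Proof. by move=> a b; exact/val_inj. Qed.
Fact deg0_nonneg_monoid : monoid_morphism deg0_nonneg.
Proof. by split=> [|a b]; exact/val_inj. Qed.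
HB.instance Definition _ := GRing.isZmodMorphism.Build deg0 nonneg deg0_nonneg
  deg0_nonneg_zmod.
HB.instance Definition _ := GRing.isMonoidMorphism.Build deg0 nonneg deg0_nonneg
  deg0_nonneg_monoid.

Record hpart (n : int) := HPart { hpart_val : R; _ : hpart_val \in G n }.
HB.instance Definition _ n := [isSub for @hpart_val n].
HB.instance Definition _ n := [Choice of hpart n by <:].
HB.instance Definition _ n := GRing.SubChoice_isSubZmodule.Build R _ (hpart n)
  (zmodClosedP (G n)).
HB.instance Definition _ n := GRing.Additive.copy (@hpart_val n) (val : hpart n -> R).

(* R_n carries both a right and a left R_0-module structure; each alias bears
   one of them. *)
Definition hpart_right (n : int) : Type := hpart n.
Definition hpart_left (n : int) : Type := hpart n.

Section HPart.
Variable n : int.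
HB.instance Definition _ := GRing.Zmodule.on (hpart_right n).
HB.instance Definition _ := GRing.Zmodule.on (hpart_left n).

Fact hpart_rP (x : hpart n) (a : deg0) : val x * val a \in G n.
Proof. by have := homogM (valP x) (valP a); rewrite addr0. Qed.
Definition hpart_rscale (a : deg0^c) (x : hpart_right n) : hpart_right n :=
  HPart (hpart_rP x a).
Fact hpart_rscaleA a b x :
  hpart_rscale a (hpart_rscale b x) = hpart_rscale (a * b) x.
Proof. by apply/val_inj; rewrite /= -mulrA. Qed.
Fact hpart_rscale1 : left_id 1 hpart_rscale.
Proof. by move=> x; apply/val_inj; rewrite /= mulr1. Qed.
Fact hpart_rscaleDr : right_distributive hpart_rscale +%R.
Proof. by move=> a x y; apply/val_inj; rewrite /= mulrDl. Qed.
Fact hpart_rscaleDl x : {morph hpart_rscale^~ x : a b / a + b}.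
Proof. by move=> a b; apply/val_inj; rewrite /= mulrDr. Qed.
HB.instance Definition _ := GRing.Zmodule_isLmodule.Build deg0^c (hpart_right n)
  hpart_rscaleA hpart_rscale1 hpart_rscaleDr hpart_rscaleDl.

Fact hpart_lP (a : deg0) (x : hpart n) : val a * val x \in G n.
Proof. by have := homogM (valP a) (valP x); rewrite add0r. Qed.
Definition hpart_lscale (a : deg0) (x : hpart_left n) : hpart_left n :=
  HPart (hpart_lP a x).
Fact hpart_lscaleA a b x :
  hpart_lscale a (hpart_lscale b x) = hpart_lscale (a * b) x.
Proof. by apply/val_inj; rewrite /= mulrA. Qed.
Fact hpart_lscale1 : left_id 1 hpart_lscale.
Proof. by move=> x; apply/val_inj; rewrite /= mul1r. Qed.
Fact hpart_lscaleDr : right_distributive hpart_lscale +%R.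
Proof. by move=> a x y; apply/val_inj; rewrite /= mulrDr. Qed.
Fact hpart_lscaleDl x : {morph hpart_lscale^~ x : a b / a + b}.
Proof. by move=> a b; apply/val_inj; rewrite /= mulrDl. Qed.
HB.instance Definition _ := GRing.Zmodule_isLmodule.Build deg0 (hpart_left n)
  hpart_lscaleA hpart_lscale1 hpart_lscaleDr hpart_lscaleDl.

Fact hpart_mulP (x : hpart n) (y : hpart (- n)) : val x * val y \in G 0.
Proof. by have := homogM (valP x) (valP y); rewrite subrr. Qed.
Definition hpart_mul (x : hpart_right n) (y : hpart_left (- n)) : deg0 :=
  Deg0 (hpart_mulP x y).
End HPart.

Fact hpart_mul_balanced n : balanced (@hpart_mul n).
Proof.
split=> [x x' y|x y y'|x a y]; apply/val_inj => /=; first exact: mulrDl.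
  exact: mulrDr.
by rewrite mulrA.
Qed.

(* R_n (x)_(R_0) R_(-n) -> R_0. *)
Definition mult_map (n : int) : tens (hpart_right n) (hpart_left (- n)) -> deg0 :=
  tlift (@hpart_mul n).

Definition strongly_graded : Prop :=
  forall n (r : deg0), exists x, mult_map (n := n) x = r.

(* t^-m P as a right P-module. *)
Record tshift (m : int) := TShift { tshift_val : R; _ : tshift_val \in from_deg (- m) }.
HB.instance Definition _ m := [isSub for @tshift_val m].
HB.instance Definition _ m := [Choice of tshift m by <:].
HB.instance Definition _ m := GRing.SubChoice_isSubZmodule.Build R (from_deg (- m))
  (tshift m) (from_deg_zmod_closed (- m)).
HB.instance Definition _ m := GRing.Additive.copy (@tshift_val m) (val : tshift m -> R).

Section TShift.
Variable m : int.
Fact shift_scaleP (x : tshift m) (a : nonneg) : val x * val a \in from_deg (- m).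
Proof. by have := from_degM (valP x) (valP a); rewrite addr0. Qed.
Definition shift_scale (a : nonneg^c) (x : tshift m) : tshift m :=
  TShift (shift_scaleP x a).
Fact shift_scaleA a b x :
  shift_scale a (shift_scale b x) = shift_scale (a * b) x.
Proof. by apply/val_inj; rewrite /= -mulrA. Qed.
Fact shift_scale1 : left_id 1 shift_scale.
Proof. by move=> x; apply/val_inj; rewrite /= mulr1. Qed.
Fact shift_scaleDr : right_distributive shift_scale +%R.
Proof. by move=> a x y; apply/val_inj; rewrite /= mulrDl. Qed.
Fact shift_scaleDl x : {morph shift_scale^~ x : a b / a + b}.
Proof. by move=> a b; apply/val_inj; rewrite /= mulrDr. Qed.
HB.instance Definition _ := GRing.Zmodule_isLmodule.Build nonneg^c (tshift m)
  shift_scaleA shift_scale1 shift_scaleDr shift_scaleDl.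
End TShift.

Definition suitable k (A : 'M[R]_k) (m : int) : Prop :=
  forall i j, A i j \in from_deg (- m).

Section Mu.
Variables (k : nat) (A : 'M[R]_k) (m : int) (hA : suitable A m).
Fact mu_map_subproof (x : {ffun 'I_k -> nonneg}) i :
  \sum_j A i j * val (x j) \in from_deg (- m).
Proof.
by apply: rpred_sum => j _; have := from_degM (hA i j) (valP (x j)); rewrite addr0.
Qed.
(* The free right P-module P^k is {ffun 'I_k -> P^c^o}. *)
Definition mu_map (x : {ffun 'I_k -> nonneg^c^o}) : {ffun 'I_k -> tshift m} :=
  [ffun i => TShift (mu_map_subproof x i)].
Fact mu_map_linear : linear mu_map.
Proof.
move=> a x y; apply/ffunP => i; rewrite !ffunE; apply/val_inj => /=.
rewrite mulr_suml -big_split; apply: eq_bigr => j _ /=.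
by rewrite !ffunE /= mulrDr mulrA.
Qed.
HB.instance Definition _ := GRing.isLinear.Build nonneg^c
  {ffun 'I_k -> nonneg^c^o} {ffun 'I_k -> tshift m} _ mu_map mu_map_linear.
End Mu.

Definition lmulmx k (A : 'M[R]_k) (x : {ffun 'I_k -> R^c^o}) : {ffun 'I_k -> R^c^o} :=
  [ffun i => \sum_j A i j * (x j : R)].
Fact lmulmx_linear k (A : 'M[R]_k) : linear (lmulmx A).
Proof.
move=> a x y; apply/ffunP => i; rewrite !ffunE.
rewrite scaler_sumr -big_split; apply: eq_bigr => j _.
rewrite !ffunE /= [LHS]mulrDr; congr (_ + _).
exact: (mulrA (A i j) (x j : R) (a : R)).
Qed.
HB.instance Definition _ k (A : 'M[R]_k) := GRing.isLinear.Build R^c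
  {ffun 'I_k -> R^c^o} {ffun 'I_k -> R^c^o} _ (lmulmx A) (lmulmx_linear A).

(* A Laurent series \sum_(k <= p) r_k t^k in t^-1 is the function k |-> r_k;
   since t is central, multiplication is the convolution hconv. *)
Definition laurent_pred : {pred int -> R} := fun f =>
  `[< (forall k, f k \in G k) /\ exists p, forall k, p < k -> f k = 0 >].

Fact laurent_zmod_closed : zmod_closed laurent_pred.
Proof.
split=> [|f g /asboolP[hf [p hp]] /asboolP[hg [q hq]]]; apply/asboolP; split.
- by move=> k; rewrite rpred0.
- by exists 0.
- by move=> k; apply: rpredB.
- by exists (Num.max p q) => k; rewrite gt_max => /andP[? ?];
    rewrite !fctE hp ?hq ?subr0.
Qed.

Record laurent := Laurent { lcoef : int -> R; _ : lcoef \in laurent_pred }.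
HB.instance Definition _ := [isSub for lcoef].
HB.instance Definition _ := [Choice of laurent by <:].
HB.instance Definition _ := GRing.SubChoice_isSubZmodule.Build _ laurent_pred
  laurent laurent_zmod_closed.
HB.instance Definition _ := GRing.Additive.copy lcoef (val : laurent -> (int -> R)).

Lemma convE (f g : int -> R) p q n a b :
  (forall k, p < k -> f k = 0) -> (forall k, q < k -> g k = 0) ->
  a <= n - q -> p <= b ->
  hconv f g n = \sum_(i <- zrange a b) f i * g (n - i).
Proof.
move=> hf hg ha hb; apply: sum_allE (zrange_uniq _ _) _ => i.
rewrite mem_zrange negb_and -!ltNge => /orP[hi|hi]; last by rewrite hf ?mul0r //; lia.
by rewrite hg ?mulr0 //; lia.
Qed.

Lemma conv_bound (f g : int -> R) p q n :
  (forall k, p < k -> f k = 0) -> (forall k, q < k -> g k = 0) ->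
  p + q < n -> hconv f g n = 0.
Proof.
move=> hf hg hn; apply: fsbig1 => i _; case: (ltP p i) => hi.
  by rewrite hf ?mul0r.
by rewrite hg ?mulr0 //; lia.
Qed.

Fact laurent_mulP (f g : laurent) : hconv (lcoef f) (lcoef g) \in laurent_pred.
Proof.
have /asboolP[hf [p hp]] := valP f; have /asboolP[hg [q hq]] := valP g.
apply/asboolP; split=> [n|]; last by exists (p + q) => n; apply: conv_bound.
rewrite (convE hp hq (lexx _) (lexx _)); apply: rpred_sum => i _.
exact: homogM_sub.
Qed.
Definition laurent_mul (f g : laurent) : laurent := Laurent (laurent_mulP f g).

Fact to_laurentP (x : R) : hcoef x \in laurent_pred.
Proof.
apply/asboolP; split; first exact: hcoef_homog.
have [s [_ hs _]] := hcoef_seq x; exists (\sum_(i <- s) `|i|) => k hk.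
apply: hs; apply/negP => hks; move: hk; rewrite (big_rem k) //= ltNge.
by rewrite ler_wpDr ?ler_norm ?sumr_ge0.
Qed.
Definition to_laurent (x : R) : laurent := Laurent (to_laurentP x).

Fact laurent_mulA : associative laurent_mul.
Proof.
move=> f g h; apply/val_inj/funext => n /=.
have /asboolP[_ [p hp]] := valP f; have /asboolP[_ [q hq]] := valP g.
have /asboolP[_ [r hr]] := valP h.
have hfg k : p + q < k -> hconv (lcoef f) (lcoef g) k = 0 by apply: conv_bound.
have hgh k : q + r < k -> hconv (lcoef g) (lcoef h) k = 0 by apply: conv_bound.
rewrite (convE (a := n - r - q) hp hgh _ (lexx _)); last by lia.
rewrite (convE hfg hr (lexx _) (lexx _)).
rewrite [RHS]big_seq.
under [RHS]eq_bigr => k.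
  rewrite mem_zrange => /andP[hk1 hk2].
  rewrite (convE (a := n - r - q) hp hq _ (lexx _)); last by lia.
  rewrite mulr_suml; over.
rewrite -big_seq exchange_big big_seq [RHS]big_seq /=.
apply: eq_bigr => i; rewrite mem_zrange => /andP[hi1 hi2].
under [RHS]eq_bigr do rewrite -mulrA.
rewrite -mulr_sumr; congr (_ * _).
pose F j := lcoef g j * lcoef h (n - i - j).
rewrite /hconv -(sum_all_shift F i) (sum_allE (zrange_uniq (n - r) (p + q))).
  by apply: eq_bigr => k _; rewrite /F; congr (_ * lcoef h _); lia.
move=> k; rewrite mem_zrange negb_and -!ltNge /F => /orP[hk|hk].
  by rewrite hr ?mulr0 //; lia.
by rewrite hq ?mul0r //; lia.
Qed.

Lemma hcoef1 : hcoef 1 = fun k => if k == 0 then 1 else 0.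
Proof. exact/hcoef_id/homog1. Qed.

Fact laurent_mul1 : left_id (to_laurent 1) laurent_mul.
Proof.
move=> f; apply/val_inj/funext => n /=.
rewrite /hconv hcoef1 (@sum_allE _ _ [:: 0]) //.
  by rewrite big_seq1 eqxx mul1r subr0.
by move=> k; rewrite inE => /negPf->; rewrite mul0r.
Qed.
Fact laurent_mulr1 : right_id (to_laurent 1) laurent_mul.
Proof.
move=> f; apply/val_inj/funext => n /=.
rewrite /hconv hcoef1 (@sum_allE _ _ [:: n]) //.
  by rewrite big_seq1 subrr eqxx mulr1.
by move=> k; rewrite inE subr_eq0 eq_sym => /negPf->; rewrite mulr0.
Qed.
Fact laurent_mulDl : left_distributive laurent_mul +%R.
Proof.
move=> f g h; apply/val_inj/funext => n; rewrite raddfD /=.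
have /asboolP[_ [p hp]] := valP f; have /asboolP[_ [q hq]] := valP g.
have /asboolP[_ [r hr]] := valP h.
set b := Num.max p q.
have [hpb hqb] : p <= b /\ q <= b by rewrite !le_max !lexx orbT.
have hfg k : b < k -> (lcoef f + lcoef g) k = 0.
  by move=> hk; rewrite !fctE hp ?hq ?addr0 //; lia.
rewrite -[RHS]/(hconv (lcoef f) (lcoef h) n + hconv (lcoef g) (lcoef h) n).
rewrite (convE hfg hr (lexx _) (lexx _)).
rewrite (convE hp hr (lexx _) hpb) (convE hq hr (lexx _) hqb) -big_split.
by apply: eq_bigr => i _; rewrite !fctE mulrDl.
Qed.
Fact laurent_mulDr : right_distributive laurent_mul +%R.
Proof.
move=> h f g; apply/val_inj/funext => n; rewrite raddfD /=.
have /asboolP[_ [p hp]] := valP f; have /asboolP[_ [q hq]] := valP g.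
have /asboolP[_ [r hr]] := valP h.
set b := Num.max p q.
have [hpb hqb] : n - b <= n - p /\ n - b <= n - q.
  by rewrite !lerD2l !lerN2 !le_max !lexx orbT.
have hfg k : b < k -> (lcoef f + lcoef g) k = 0.
  by move=> hk; rewrite !fctE hp ?hq ?addr0 //; lia.
rewrite -[RHS]/(hconv (lcoef h) (lcoef f) n + hconv (lcoef h) (lcoef g) n).
rewrite (convE hr hfg (lexx _) (lexx _)).
rewrite (convE hr hp hpb (lexx _)) (convE hr hq hqb (lexx _)) -big_split.
by apply: eq_bigr => i _; rewrite !fctE mulrDr.
Qed.
HB.instance Definition _ := GRing.Zmodule_isPzRing.Build laurent
  laurent_mulA laurent_mul1 laurent_mulr1 laurent_mulDl laurent_mulDr.

Fact to_laurent_zmod : zmod_morphism to_laurent.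
Proof. by move=> x y; apply/val_inj; rewrite raddfB /= hcoefB. Qed.
Fact to_laurent_monoid : monoid_morphism to_laurent.
Proof. by split=> // x y; apply/val_inj; rewrite /= hcoefM. Qed.
HB.instance Definition _ := GRing.isZmodMorphism.Build R laurent to_laurent
  to_laurent_zmod.
HB.instance Definition _ := GRing.isMonoidMorphism.Build R laurent to_laurent
  to_laurent_monoid.

(* Omega_+. The empty matrix is left out; it would only ask for the inversion
   of 0 -> 0. *)
Definition omega_plus k (A : 'M[R]_k) : Prop :=
  (0 < k)%N /\ exists B : 'M[laurent]_k,
    map_mx to_laurent A *m B = 1%:M /\ B *m map_mx to_laurent A = 1%:M.

Inductive omega_nonneg : hom_class nonneg :=
  OmegaNonneg k (A : 'M[R]_k) m (hA : suitable A m) :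
    omega_plus A -> @omega_nonneg _ _ (mu_map hA).

Inductive omega_full : hom_class R :=
  OmegaFull k (A : 'M[R]_k) : omega_plus A -> @omega_full _ _ (lmulmx A).

End Grading.

Arguments nonneg_val {R} G n : rename.
Arguments deg0_nonneg {R} G a.
Arguments strongly_graded {R} G.
Arguments omega_nonneg {R} G [M N] s : rename.
Arguments omega_full {R} G [M N] s : rename.

(* Main.v *)
From HB Require Import structures.
Require Import Defs.
From mathcomp Require Import all_boot all_order all_algebra zify.
From mathcomp Require Import boolp functions.
Set Implicit Arguments.
Unset Strict Implicit.
Unset Printing Implicit Defensive.
Import Order.TTheory GRing.Theory Num.Theory.
Local Open Scope ring_scope.

(* Write L for the ring of Laurent series. We go around the circle
   (1) -> C (x) L contractible -> (2) -> (3) -> C (x) L contractible -> (1).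

   Let s be a contraction of C (x) L. Truncating its entries in low degrees gives
   matrices s over R for which phi = d s + s d is 1 plus terms of negative degree,
   hence lies in Omega_+. For suitable m, phi is a nullhomotopic chain map
   C -> t^-m C. Inverting it contracts C, which gives (2); and division with
   remainder by phi splits t^-m C, over R_0, as phi(C) plus the part in degrees
   -m, ..., -1. The latter is finitely generated projective over R_0 because R is
   strongly graded, and C is a homotopy retract of the resulting complex since phi
   is nullhomotopic.

   If a matrix A is invertible over S then so is mu(A, m) (x) S, because
   t^-m P (x)_P S = S. Hence R -> Omega_+^-1 R factors on P through Omega_+^-1 P,
   and R -> L factors through Omega_+^-1 R.

   Finally let C be a homotopy retract of a finite free complex D over R_0. There
   is a resolution 0 -> X -> X -> C (x)_P L -> 0 with X = C (x)_(R_0) L and first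
   map 1 - sigma, where sigma (c (x) x) = sum_a c u_a (x) v_a x for a decomposition
   1 = sum_a u_a v_a in R_1 R_(-1). On D (x)_(R_0) L the map sigma turns into an
   endomorphism lowering degrees; so 1 - sigma becomes invertible there, and
   C (x)_P L is contractible. *)

(** * Right modules, bases and base change *)

Definition rsc (K : pzRingType) (M : rmodType K) (m : M) (a : K) : M :=
  (a : K^c) *: m.

Section RightScaling.
Variables (K : pzRingType) (M : rmodType K).
Implicit Types (m : M) (a : K).

Lemma rscDl m m' a : rsc (m + m') a = rsc m a + rsc m' a.
Proof. exact: scalerDr. Qed.
Lemma rscDr m a b : rsc m (a + b) = rsc m a + rsc m b.
Proof. exact: scalerDl. Qed.
Lemma rscA m a b : rsc (rsc m a) b = rsc m (a * b).
Proof. exact: scalerA. Qed.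
Lemma rsc1 m : rsc m 1 = m.
Proof. exact: scale1r. Qed.
Lemma rsc0 a : rsc (0 : M) a = 0.
Proof. exact: scaler0. Qed.
Lemma rscr0 m : rsc m 0 = 0.
Proof. exact: scale0r. Qed.
Lemma rscNl m a : rsc (- m) a = - rsc m a.
Proof. exact: scalerN. Qed.
Lemma rsc_suml (I : Type) (r : seq I) (F : I -> M) a :
  rsc (\sum_(i <- r) F i) a = \sum_(i <- r) rsc (F i) a.
Proof. exact: scaler_sumr. Qed.
Lemma rsc_sumr (I : Type) (r : seq I) (F : I -> K) m :
  rsc m (\sum_(i <- r) F i) = \sum_(i <- r) rsc m (F i).
Proof. exact: (@scaler_suml K^c M m I r predT F). Qed.

Lemma lin_rsc (N : rmodType K) (g : {linear M -> N}) m a :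
  g (rsc m a) = rsc (g m) a.
Proof. exact: linearZ. Qed.
End RightScaling.

Lemma rsc_reg (K : pzRingType) (x : K^c^o) (a : K) : rsc x a = (x : K) * a.
Proof. by []. Qed.

Lemma rsc_ffun (K : pzRingType) (I : finType) (M : rmodType K)
  (x : {ffun I -> M}) (a : K) i : rsc x a i = rsc (x i) a.
Proof. by rewrite /rsc ffunE. Qed.

Definition mk_lin (K : pzRingType) (M N : rmodType K) (f : M -> N)
    (fD : forall x y, f (x + y) = f x + f y)
    (fZ : forall x a, f (rsc x a) = rsc (f x) a) :
  {g : {linear M -> N} | g =1 f}.
Proof.
have fL : linear f by move=> a x y; rewrite fD; congr (_ + _); exact: fZ.
pose g : {linear M -> N} := HB.pack f (GRing.isLinear.Build _ _ _ _ f fL).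
by exists g.
Defined.

Lemma lin_inv (K : pzRingType) (M N : rmodType K) (g : {linear M -> N}) :
  bijective g -> {h : {linear N -> M} | cancel g h /\ cancel h g}.
Proof.
move=> g_bij; apply: cid; case: g_bij => h hK gK; have ginj := can_inj hK.
have [||h' hE] := @mk_lin K N M h.
- by move=> x y; apply: ginj; rewrite linearD !gK.
- by move=> x a; apply: ginj; rewrite lin_rsc !gK.
by exists h'; split=> x; rewrite hE ?hK ?gK.
Qed.

Section PureTensors.
Variables (K S : pzRingType) (f : {rmorphism K -> S}).
Implicit Types M N : rmodType K.

Definition tp M (m : M) (s : S) : ext_mod f M := tpure m (s : lrestr f S^o).

Lemma tpDl M (m m' : M) s : tp (m + m') s = tp m s + tp m' s.
Proof. by have [h _ _] := @tpure_balanced K M (lrestr f S^o); exact: h. Qed.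
Lemma tpDr M (m : M) s s' : tp m (s + s') = tp m s + tp m s'.
Proof. by have [_ h _] := @tpure_balanced K M (lrestr f S^o); exact: h. Qed.
Lemma tp_rscl M (m : M) a s : tp (rsc m a) s = tp m (f a * s).
Proof. by have [_ _ h] := @tpure_balanced K M (lrestr f S^o); exact: h. Qed.
Lemma tp_rscr M (m : M) s a : rsc (tp m s) a = tp m (s * a).
Proof. exact: ext_pureZ. Qed.
Lemma tp1 M (m : M) s : tp m s = rsc (tp m 1) s.
Proof. by rewrite tp_rscr mul1r. Qed.
Lemma tp0l M s : tp (0 : M) s = 0.
Proof. by apply: (@addrI _ (tp (0 : M) s)); rewrite -tpDl !addr0. Qed.
Lemma tp0r M (m : M) : tp m 0 = 0.
Proof. by apply: (@addrI _ (tp m 0)); rewrite -tpDr !addr0. Qed.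
Lemma tp_suml M (I : Type) (r : seq I) (F : I -> M) s :
  tp (\sum_(i <- r) F i) s = \sum_(i <- r) tp (F i) s.
Proof. exact: (big_morph (fun m => tp m s) (fun m m' => tpDl m m' s) (tp0l M s)). Qed.
Lemma tp_sumr M (I : Type) (r : seq I) (F : I -> S) (m : M) :
  tp m (\sum_(i <- r) F i) = \sum_(i <- r) tp m (F i).
Proof. exact: (big_morph (tp m) (tpDr m) (tp0r m)). Qed.

Lemma ext_map_tp M N (g : {linear M -> N}) m s : ext_map f g (tp m s) = tp (g m) s.
Proof. exact: ext_map_pure. Qed.

Lemma ext_ind M (Q : ext_mod f M -> Prop) :
  Q 0 -> (forall m s x, Q x -> Q (tp m s + x)) -> forall x, Q x.
Proof. by move=> Q0 QD x;
  exact: (@tens_ind K M (lrestr f S^o) Q Q0 (fun m s x => QD m s x) x).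
Qed.

Lemma ext_eq M (W : zmodType) (g h : {additive ext_mod f M -> W}) :
  (forall m s, g (tp m s) = h (tp m s)) -> g =1 h.
Proof.
move=> gh; elim/ext_ind => [|m s x IHx]; first by rewrite !raddf0.
by rewrite !raddfD IHx gh.
Qed.

(** The adjunction between extension and restriction of scalars: the two hypotheses make [b] a
    [K]-linear map into the restriction of [N] along [f]. *)
Lemma ext_lin M (N : rmodType S) (b : M -> N) :
  (forall x y, b (x + y) = b x + b y) ->
  (forall x a, b (rsc x a) = rsc (b x) (f a)) ->
  {g : {linear ext_mod f M -> N} | forall m s, g (tp m s) = rsc (b m) s}.
Proof.
move=> bD bZ; pose B (m : M) (s : lrestr f S^o) : N := rsc (b m) (s : S).
have balB : balanced B.
  split=> [m m' s|m s s'|m a s]; rewrite /B.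
  - by rewrite bD rscDl.
  - exact: rscDr.
  - by rewrite (bZ m a) rscA.
have gD := tliftD balB.
have g0 : tlift B 0 = 0 by apply: (addrI (tlift B 0)); rewrite -gD !addr0.
have gE m s : tlift B (tp m s) = rsc (b m) s by exact: tlift_pure.
have [||g gg] := @mk_lin S (ext_mod f M) N (tlift B).
- exact: gD.
- move=> x a; elim/ext_ind: x => [|m s x IHx]; first by rewrite rsc0 g0 rsc0.
  by rewrite rscDl !gD IHx tp_rscr !gE rscDl rscA.
by exists g => m s; rewrite gg gE.
Qed.
End PureTensors.

Lemma ext_map_comp (K S : pzRingType) (f : {rmorphism K -> S}) (M N Q : rmodType K)
    (g : {linear N -> Q}) (h : {linear M -> N}) (k : {linear M -> Q}) :
  (forall x, k x = g (h x)) -> forall x, ext_map f k x = ext_map f g (ext_map f h x).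
Proof.
by move=> kE; apply: (@ext_eq _ _ f _ _ _ (ext_map f g \o ext_map f h)) => m s /=;
  rewrite !ext_map_tp kE.
Qed.

(** Vectors come together with their dual basis: coordinates that are linear maps extend along a
    ring homomorphism just as the vectors do. *)
Record basis (K : pzRingType) (M : rmodType K) := Basis {
  rk : nat;
  bv : 'I_rk -> M;
  bco : 'I_rk -> {linear M -> K^c^o};
  bE : forall m, m = \sum_i rsc (bv i) (bco i m : K);
  bK : forall i j, bco i (bv j) = (i == j)%:R :> K
}.
Arguments bv {K M} b i.
Arguments bco {K M} b i.

Section FreeModules.
Variable K : pzRingType.
Implicit Types M N Q : rmodType K.

Lemma basis_ext M N (b : basis M) (g h : {linear M -> N}) :
  (forall j, g (bv b j) = h (bv b j)) -> g =1 h.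
Proof.
move=> gh m; rewrite (bE b m) !linear_sum; apply: eq_bigr => i _.
by rewrite !lin_rsc gh.
Qed.

Lemma basis_fun M N (b : basis M) (w : 'I_(rk b) -> N) :
  {g : {linear M -> N} | forall j, g (bv b j) = w j}.
Proof.
have [||g gE] := @mk_lin K M N (fun m => \sum_i rsc (w i) (bco b i m : K)).
- by move=> x y; rewrite -big_split; apply: eq_bigr => i _; rewrite linearD rscDr.
- by move=> x a; rewrite rsc_suml; apply: eq_bigr => i _; rewrite lin_rsc rscA.
exists g => j; rewrite gE (bigD1 j) //= bK eqxx rsc1 big1 ?addr0 // => i ij.
by rewrite bK (negPf ij) rscr0.
Qed.

(** [g] is a bare function, so that composites and sums can be written as plain lambda terms. *)
Definition mx_of M N (bM : basis M) (bN : basis N) (g : M -> N) : 'M[K]_(rk bN, rk bM) :=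
  \matrix_(i, j) (bco bN i (g (bv bM j)) : K).

Definition lin_of M N (bM : basis M) (bN : basis N) (A : 'M[K]_(rk bN, rk bM)) :
   {linear M -> N} := sval (basis_fun (fun j => \sum_i rsc (bv bN i) (A i j))).

Lemma bco_lin M N (bM : basis M) (bN : basis N) (g : {linear M -> N}) i m :
  bco bN i (g m) = \sum_j mx_of bM bN g i j * (bco bM j m : K) :> K.
Proof.
rewrite {1}(bE bM m) !linear_sum; apply: eq_bigr => j _.
by rewrite !lin_rsc rsc_reg mxE.
Qed.

Lemma bco_sum M (b : basis M) (w : 'I_(rk b) -> K) i :
  bco b i (\sum_j rsc (bv b j) (w j)) = w i :> K.
Proof.
rewrite linear_sum (bigD1 i) //= lin_rsc bK eqxx rsc_reg mul1r big1 ?addr0 // => j ji.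
by rewrite lin_rsc bK eq_sym (negPf ji) rsc_reg mul0r.
Qed.

Lemma bco_inj M (b : basis M) m m' : (forall i, bco b i m = bco b i m') -> m = m'.
Proof.
by move=> h; rewrite (bE b m) (bE b m'); apply: eq_bigr => i _; rewrite h.
Qed.

Lemma lin_ofK M N (bM : basis M) (bN : basis N) A : mx_of bM bN (lin_of A) = A.
Proof.
apply/matrixP => i j; rewrite mxE /lin_of; case: basis_fun => g /= ->.
exact: bco_sum.
Qed.

Lemma mx_of_inj M N (bM : basis M) (bN : basis N) (g h : {linear M -> N}) :
  mx_of bM bN g = mx_of bM bN h -> g =1 h.
Proof.
move=> /matrixP gh; apply: (@basis_ext _ _ bM) => j; apply: (@bco_inj _ bN) => i.
by have := gh i j; rewrite !mxE.
Qed.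

Lemma mx_of_comp M N Q (bM : basis M) (bN : basis N) (bQ : basis Q)
    (g : {linear N -> Q}) (h : M -> N) :
  mx_of bM bQ (fun x => g (h x)) = mx_of bN bQ g *m mx_of bM bN h.
Proof.
apply/matrixP => i j; rewrite !mxE (bco_lin bN).
by apply: eq_bigr => l _; rewrite [mx_of _ _ h _ _]mxE.
Qed.

Lemma mx_ofD M N (bM : basis M) (bN : basis N) (g h : M -> N) :
  mx_of bM bN (fun x => g x + h x) = mx_of bM bN g + mx_of bM bN h.
Proof. by apply/matrixP => i j; rewrite !mxE linearD. Qed.

Lemma mx_of1 M (b : basis M) : mx_of b b (fun x => x) = 1%:M.
Proof. by apply/matrixP => i j; rewrite !mxE bK. Qed.

Lemma lin_of_comp M N Q (bM : basis M) (bN : basis N) (bQ : basis Q)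
    (A : 'M_(rk bQ, rk bN)) (B : 'M_(rk bN, rk bM)) x :
  lin_of A (lin_of B x) = lin_of (A *m B) x.
Proof.
apply: (@mx_of_inj _ _ bM bQ (lin_of A \o lin_of B)).
by rewrite (mx_of_comp bM bN bQ) !lin_ofK.
Qed.

Lemma lin_of1 M (b : basis M) x : lin_of (1%:M : 'M_(rk b, rk b)) x = x.
Proof. by apply: (@mx_of_inj _ _ b b _ idfun); rewrite lin_ofK mx_of1. Qed.

Lemma mx_of_bij M N (bM : basis M) (bN : basis N) (g : {linear M -> N})
    (B : 'M_(rk bM, rk bN)) :
  mx_of bM bN g *m B = 1%:M -> B *m mx_of bM bN g = 1%:M -> bijective g.
Proof.
move=> gB Bg; have gE x : g x = lin_of (mx_of bM bN g) x.
  by apply: (@mx_of_inj _ _ bM bN); rewrite lin_ofK.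
by exists (lin_of B) => x; rewrite gE lin_of_comp ?gB ?Bg lin_of1.
Qed.

Lemma bij_mx_of M N (bM : basis M) (bN : basis N) (g : {linear M -> N}) :
  bijective g -> exists B : 'M_(rk bM, rk bN),
    mx_of bM bN g *m B = 1%:M /\ B *m mx_of bM bN g = 1%:M.
Proof.
case/lin_inv=> h [hK gK].
exists (mx_of bN bM h); rewrite -!mx_of_comp -(mx_of1 bM) -(mx_of1 bN).
by split; apply/matrixP => i j; rewrite !mxE ?gK ?hK.
Qed.

Lemma fg_free_basis M : fg_free M -> exists b : basis M, True.
Proof.
case=> n [g /lin_inv[h [hK gK]]].
have co i : {c : {linear M -> K^c^o} | forall m, c m = h m i}.
  by apply: mk_lin => [x y|x a]; rewrite ?linearD ?lin_rsc ?rsc_ffun ?ffunE.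
pose e (i : 'I_n) := g [ffun j => (j == i)%:R : K^c^o].
have hE m : m = \sum_i rsc (e i) (sval (co i) m : K).
  rewrite -{1}[m]gK; under eq_bigr do rewrite -lin_rsc.
  rewrite -linear_sum; congr (g _); apply/ffunP => j; rewrite sum_ffunE (bigD1 j) //=.
  rewrite rsc_ffun ffunE eqxx rsc_reg mul1r (svalP (co j)) big1 ?addr0 // => i ij.
  by rewrite rsc_ffun ffunE eq_sym (negPf ij) rsc_reg mul0r.
have hK' i j : sval (co i) (e j) = (i == j)%:R :> K.
  by rewrite (svalP (co i)) hK ffunE.
by exists (Basis hE hK').
Qed.

(** Over the zero ring a zero module also has bases of positive rank. Rank 0 outside finitely many
    degrees is what makes bounds over all degrees possible. *)
Definition basis0 M (M0 : forall x : M, x = 0) : basis M.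
Proof.
apply: (@Basis K M 0 (fun=> 0) (fun=> (\0 : {linear M -> K^c^o}))); last by case.
by move=> m; rewrite big_ord0 (M0 m).
Defined.
End FreeModules.

Section BaseChange.
Variables (K S : pzRingType) (f : {rmorphism K -> S}).

Section Basis.
Variables (M : rmodType K) (b : basis M).

Fact ext_bco_subproof i : {c : {linear ext_mod f M -> S^c^o} |
  forall m s, c (tp f m s) = f (bco b i m) * s :> S}.
Proof.
apply: (@ext_lin _ _ f M S^c^o (fun m => f (bco b i m))).
  by move=> x y; rewrite linearD rmorphD.
by move=> x a; rewrite lin_rsc !rsc_reg rmorphM.
Qed.

Definition ext_bco_lin i := sval (ext_bco_subproof i).

Lemma ext_bcoE i m s : ext_bco_lin i (tp f m s) = f (bco b i m) * s :> S.
Proof. exact: svalP (ext_bco_subproof i) m s. Qed.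

Fact ext_bE x : x = \sum_i rsc (tp f (bv b i) 1) (ext_bco_lin i x : S).
Proof.
pose F x := \sum_i rsc (tp f (bv b i) 1) (ext_bco_lin i x : S).
have [||g gE] := @mk_lin S (ext_mod f M) (ext_mod f M) F.
- by move=> y z; rewrite -big_split; apply: eq_bigr => i _; rewrite linearD rscDr.
- by move=> y a; rewrite rsc_suml; apply: eq_bigr => i _; rewrite lin_rsc rscA.
rewrite -/(F x) -gE; move: x; apply: (@ext_eq _ _ f M _ idfun g) => m s /=.
rewrite gE /F {1}(bE b m) tp_suml; apply: eq_bigr => i _.
by rewrite ext_bcoE tp_rscr mul1r tp_rscl.
Qed.

Fact ext_bK i j : ext_bco_lin i (tp f (bv b j) 1) = (i == j)%:R :> S.
Proof. by rewrite ext_bcoE bK mulr1 rmorph_nat. Qed.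

Definition ext_basis : basis (ext_mod f M) := Basis ext_bE ext_bK.
End Basis.

Lemma ext_bco (M : rmodType K) (b : basis M) i m s :
  bco (ext_basis b) i (tp f m s) = f (bco b i m) * s :> S.
Proof. exact: ext_bcoE. Qed.

Lemma ext_bv (M : rmodType K) (b : basis M) i :
  bv (ext_basis b) i = tp f (bv b i) 1.
Proof. by []. Qed.

Lemma mx_of_ext (M N : rmodType K) (bM : basis M) (bN : basis N) (g : {linear M -> N}) :
  mx_of (ext_basis bM) (ext_basis bN) (ext_map f g) = map_mx f (mx_of bM bN g).
Proof.
by apply/matrixP => i j; rewrite !mxE ext_bv ext_map_tp ext_bco mulr1.
Qed.
End BaseChange.

(** * Contractions *)

Lemma contractibleP (K : pzRingType) (C : chain_complex K) :
  contractible C <-> exists h : forall n, {linear C n -> C (n + 1)},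
    forall n (x : C (n + 1)), x = bd C (n + 1) (h (n + 1) x) + h n (bd C n x).
Proof.
by split=> -[h hE]; exists h => n x; rewrite -hE /= subr0.
Qed.

Section Contraction.
Variables (K : pzRingType) (C : chain_complex K) (b : forall n, basis (C n)).

Definition bdmx n : 'M[K]_(rk (b n), rk (b (n + 1))) := mx_of (b (n + 1)) (b n) (bd C n).

Lemma bdmxK n : bdmx n *m bdmx (n + 1) = 0.
Proof.
rewrite -mx_of_comp; apply/matrixP => i j.
by rewrite !mxE bdK linear0.
Qed.

(** In bases a contraction is a solution of a matrix equation over [S]. Such solutions can be pushed
    along ring homomorphisms and truncated entrywise. *)
Lemma contractible_mxP (S : pzRingType) (f : {rmorphism K -> S}) :
  contractible (extend_scalars f C) <->
  exists s : forall n, 'M[S]_(rk (b (n + 1)), rk (b n)), forall n,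
    map_mx f (bdmx (n + 1)) *m s (n + 1) + s n *m map_mx f (bdmx n) = 1%:M.
Proof.
pose E := extend_scalars f C.
pose e n : basis (E n) := ext_basis f (b n).
have bdE n : map_mx f (bdmx n) = mx_of (e (n + 1)) (e n) (bd E n).
  exact/esym/(mx_of_ext f (b (n + 1)) (b n) (bd C n)).
rewrite contractibleP; split=> -[h hE].
  exists (fun n => mx_of (e n) (e (n + 1)) (h n)) => n.
  rewrite !bdE -(mx_of_comp (e (n + 1)) (e (n + 1 + 1)) (e (n + 1)) (bd E (n + 1))).
  rewrite -(mx_of_comp (e (n + 1)) (e n) (e (n + 1)) (h n)) -(mx_ofD (e (n + 1)) (e (n + 1))).
  by rewrite -(mx_of1 (e (n + 1))); apply/matrixP => i j; rewrite !mxE -hE.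
pose k n : {linear E n -> E (n + 1)} := @lin_of _ _ _ (e n) (e (n + 1)) (h n).
exists k => n x.
pose g : {linear E (n + 1) -> E (n + 1)} :=
  (bd E (n + 1) \o k (n + 1)) \+ (k n \o bd E n).
apply: (@mx_of_inj _ _ _ (e (n + 1)) (e (n + 1)) idfun g).
rewrite mx_of1 (mx_ofD _ _ (fun x => bd E (n + 1) (k (n + 1) x)) (fun x => k n (bd E n x))).
by rewrite (mx_of_comp _ (e (n + 1 + 1)) _ (bd E (n + 1))) (mx_of_comp _ (e n) _ (k n))
  !lin_ofK -!bdE hE.
Qed.

End Contraction.

Lemma contractible_transfer (K S S' : pzRingType) (C : chain_complex K)
    (b : forall n, basis (C n)) (f : {rmorphism K -> S}) (f' : {rmorphism K -> S'})
    (h : {rmorphism S -> S'}) :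
  (forall x, h (f x) = f' x) ->
  contractible (extend_scalars f C) -> contractible (extend_scalars f' C).
Proof.
move=> hf /(contractible_mxP b)[s sE]; apply/(contractible_mxP b).
exists (fun n => map_mx h (s n)) => n.
have mE p q (A : 'M_(p, q)) : map_mx f' A = map_mx h (map_mx f A).
  by apply/matrixP => i j; rewrite !mxE hf.
by rewrite !mE -!map_mxM -map_mxD sE map_mx1.
Qed.

(* The chain map phi : C -> T has the nullhomotopy h, so phi^-1 h is a contraction
   as soon as phi becomes invertible. *)
Lemma contractible_nullhomotopic (K S : pzRingType) (f : {rmorphism K -> S})
    (C : chain_complex K) (T : int -> rmodType K)
    (dT : forall n, {linear T (n + 1) -> T n})
    (h : forall n, {linear C n -> T (n + 1)})
    (phi : forall n, {linear C (n + 1) -> T (n + 1)}) :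
  (forall n x, phi n x = dT (n + 1) (h (n + 1) x) + h n (bd C n x)) ->
  (forall n x, phi n (bd C (n + 1) x) = dT (n + 1) (phi (n + 1) x)) ->
  (forall n, bijective (ext_map f (phi n))) ->
  contractible (extend_scalars f C).
Proof.
move=> phiE phid phi_bij; apply/contractibleP.
pose g n := sval (lin_inv (phi_bij n)).
have gK n : cancel (ext_map f (phi n)) (g n) by case: (svalP (lin_inv (phi_bij n))).
have Kg n : cancel (g n) (ext_map f (phi n)) by case: (svalP (lin_inv (phi_bij n))).
pose k n : {linear ext_mod f (C n) -> ext_mod f (C (n + 1))} := g n \o ext_map f (h n).
exists k => n x; apply: (can_inj (gK n)).
rewrite linearD /= Kg.
(* As phi is a chain map, phi d phi^-1 is the differential of [T]. *)
have -> : ext_map f (phi n) (ext_map f (bd C (n + 1)) (g (n + 1) (ext_map f (h (n + 1)) x)))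
   = ext_map f (dT (n + 1)) (ext_map f (h (n + 1)) x).
  rewrite -(@ext_map_comp _ _ f _ _ _ (phi n) (bd C (n + 1)) (dT (n + 1) \o phi (n + 1))).
    by rewrite (@ext_map_comp _ _ f _ _ _ (dT (n + 1)) (phi (n + 1))) // Kg.
  by move=> y; rewrite phid.
move: x; apply: (@ext_eq _ _ f _ _ (ext_map f (phi n))
  ((ext_map f (dT (n + 1)) \o ext_map f (h (n + 1)))
    \+ (ext_map f (h n) \o ext_map f (bd C n)))).
by move=> m s /=; rewrite !ext_map_tp -tpDl phiE.
Qed.

Lemma ext_mod_trivial (K S : pzRingType) (f : {rmorphism K -> S}) (M : rmodType K) :
  (forall x : M, x = 0) -> forall x : ext_mod f M, x = 0.
Proof.
by move=> M0; elim/ext_ind => // m s x ->; rewrite (M0 m) tp0l addr0.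
Qed.

(* It suffices to invert d up to homotopy on cycles: with p = d K the projection
   onto cycles, (1 - p) K p is a contraction. *)
Lemma contractible_cycles (K : pzRingType) (C : chain_complex K) :
  (forall n, exists k : {linear C (n + 1 + 1) -> C (n + 1 + 1 + 1)},
    forall z, bd C (n + 1) z = 0 -> bd C (n + 1 + 1) (k z) = z) ->
  contractible C.
Proof.
move=> hk; apply/contractibleP.
(* Being a cycle makes sense only in a degree of the form [n + 1]; the transport along [e] allows a
   choice of [k] in an arbitrary degree [m]. *)
have cyc m : exists k : {linear C m -> C (m + 1)}, forall n (e : n + 1 = m) (z : C (n + 1)),
    bd C n z = 0 ->
    bd C m (k (eq_rect _ (fun j => C j : Type) z _ e)) = eq_rect _ (fun j => C j : Type) z _ e.
  have [n ->] : exists n, m = n + 1 + 1 by exists (m - 1 - 1); rewrite !subrK.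
  have [k kE] := hk n; exists k => n' e z dz.
  have e' := addIr _ e; subst n'; rewrite (Prop_irrelevance e erefl) /=.
  exact: kE.
pose k n := sval (cid (cyc n)).
have kE n z : bd C n z = 0 -> bd C (n + 1) (k (n + 1) z) = z.
  by move=> dz; have := svalP (cid (cyc (n + 1))) n erefl z dz.
pose s n : {linear C n -> C (n + 1)} :=
  (k n \o bd C n \o k n) \- (bd C (n + 1) \o k (n + 1) \o k n \o bd C n \o k n).
exists s => n x.
have pK y : bd C (n + 1) (k (n + 1) (bd C (n + 1) y)) = bd C (n + 1) y.
  by apply: kE; rewrite bdK.
have pKn y : bd C n (k n (bd C n y)) = bd C n y.
  have [m e] : exists m, n = m + 1 by exists (n - 1); rewrite subrK.
  by subst n; apply: kE; rewrite bdK.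
rewrite /s /= linearB bdK subr0 pK pKn.
(* x - k d x is a cycle, hence fixed by d k. *)
have /kE : bd C n (x - k n (bd C n x)) = 0 by rewrite linearB pKn subrr.
by rewrite !linearB => AB; rewrite addrCA AB addrC subrK.
Qed.

(** * The degree filtration of Laurent series *)

Section Laurent.
Variables (R : pzRingType) (G : zgrading R).
Implicit Types (f g : laurent G) (p q : int) (x y : R).

Local Notation toL := (@to_laurent R G).
Local Notation L := (laurent G).

Lemma hcoef_eq0 x : (forall k, hcoef G x k = 0) -> x = 0.
Proof.
move=> h; have [s [_ _ ->]] := hcoef_seq G x; apply: big1 => k _; exact: h.
Qed.

Lemma hcoefMr i x a j : a \in G i -> hcoef G (x * a) j = hcoef G x (j - i) * a.
Proof.
move=> ha; rewrite hcoefM /hconv (hcoef_id ha) (@sum_allE _ _ [:: j - i]) //.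
  by rewrite big_seq1 subKr eqxx.
move=> k; rewrite inE => hk; case: eqP => [ji|]; last by rewrite mulr0.
by case/eqP: hk; rewrite -ji subKr.
Qed.

Lemma hcoefD x y j : hcoef G (x + y) j = hcoef G x j + hcoef G y j.
Proof.
have hN z : hcoef G (- z) = - hcoef G z by rewrite -sub0r hcoefB hcoef0 sub0r.
by rewrite -[y in LHS]opprK hcoefB hN opprK fctE.
Qed.

Definition lle p f := forall k, p < k -> lcoef f k = 0.

Lemma lleE f : exists2 p, 0 <= p & lle p f.
Proof.
have /asboolP[_ [p hp]] := valP f; exists (Num.max 0 p); first by rewrite le_max lexx.
by move=> k; rewrite gt_max => /andP[_ /hp].
Qed.

Lemma lle_mono p q f : p <= q -> lle p f -> lle q f.
Proof. by move=> pq hf k /(le_lt_trans pq)/hf. Qed.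

Lemma lle0 p : lle p 0. Proof. by move=> k. Qed.

Lemma lleD p f g : lle p f -> lle p g -> lle p (f + g).
Proof. by move=> hf hg k hk; rewrite raddfD /= !fctE hf ?hg ?addr0. Qed.

Lemma lleN p f : lle p f -> lle p (- f).
Proof. by move=> hf k hk; rewrite raddfN /= !fctE hf ?oppr0. Qed.

Lemma lleB p f g : lle p f -> lle p g -> lle p (f - g).
Proof. by move=> hf hg; apply/lleD/lleN. Qed.

Lemma lleM p q f g : lle p f -> lle q g -> lle (p + q) (f * g).
Proof. by move=> hf hg k; apply: conv_bound. Qed.

Lemma lle_sum p (I : Type) (r : seq I) (F : I -> L) :
  (forall i, lle p (F i)) -> lle p (\sum_(i <- r) F i).
Proof.
move=> hF; elim/big_rec: _ => [|i f _ hf]; first exact: lle0.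
exact: lleD.
Qed.

Lemma lle_eq0 f : (forall N : nat, lle (- N%:Z) f) -> f = 0.
Proof.
move=> h; apply/val_inj/funext => k; rewrite [LHS](h `|k|.+1) //; lia.
Qed.

Lemma lle_to x p : x \in G p -> lle p (toL x).
Proof. by move=> /hcoef_id hx k hk; rewrite /= hx gt_eqF. Qed.

Lemma lcoef_homog f k : lcoef f k \in G k.
Proof. by have /asboolP[h _] := valP f; apply: h. Qed.

(** The two hypotheses bound the support from both sides and leave no degree. Uniqueness of
    truncations rests on this. *)
Lemma lle_from_deg0 q x : x \in from_deg G q -> lle (q - 1) (toL x) -> x = 0.
Proof.
move=> /from_degP hx hl; apply: hcoef_eq0 => k; case: (ltP k q) => kq.
  exact: hx.
by apply: hl; lia.
Qed.

(** Only finitely many coefficients of [f] sit in degrees at least [q], so they add up to an element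
    of [R]. *)
Lemma lle_trunc q f : exists2 x, x \in from_deg G q & lle (q - 1) (f - toL x).
Proof.
have [p _ hp] := lleE f; set s := zrange q p.
pose c k := if k \in s then lcoef f k else 0.
have hx : hcoef G (\sum_(k <- s) c k) = c.
  apply: (@hcoef_unique _ G _ _ s) => //; last 1 first.
  - by move=> k /negPf hk; rewrite /c hk.
  - by move=> k; rewrite /c; case: ifP => _; rewrite ?rpred0 ?lcoef_homog.
  - exact: zrange_uniq.
exists (\sum_(k <- s) c k).
  by apply/from_degP => k kq; rewrite hx /c mem_zrange; case: ifP => //; lia.
move=> k qk; rewrite raddfB /= hx !fctE /c mem_zrange; case: ifP => hk.
  by rewrite subrr.
by rewrite subr0 hp //; lia.
Qed.

Definition mlle p m n (A : 'M[L]_(m, n)) := forall i j, lle p (A i j).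

Lemma mlleD p m n (A B : 'M[L]_(m, n)) : mlle p A -> mlle p B -> mlle p (A + B).
Proof. by move=> hA hB i j; rewrite mxE; apply: lleD. Qed.
Lemma mlleB p m n (A B : 'M[L]_(m, n)) : mlle p A -> mlle p B -> mlle p (A - B).
Proof. by move=> hA hB i j; rewrite !mxE; apply: lleB. Qed.
Lemma mlleM p q m n l (A : 'M[L]_(m, n)) (B : 'M[L]_(n, l)) :
  mlle p A -> mlle q B -> mlle (p + q) (A *m B).
Proof. by move=> hA hB i j; rewrite mxE; apply: lle_sum => k; apply: lleM. Qed.
Lemma mlle_mono p q m n (A : 'M[L]_(m, n)) : p <= q -> mlle p A -> mlle q A.
Proof. by move=> pq hA i j; apply: lle_mono (hA i j). Qed.
Lemma mlle_eq0 m n (A : 'M[L]_(m, n)) : (forall N : nat, mlle (- N%:Z) A) -> A = 0.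
Proof. by move=> h; apply/matrixP => i j; rewrite mxE; apply: lle_eq0 => N; apply: h. Qed.
Lemma mlleE m n (A : 'M[L]_(m, n)) : exists2 p, 0 <= p & mlle p A.
Proof.
pose b i j := sval (cid2 (lleE (A i j))).
have b0 i j : 0 <= b i j by rewrite /b; case: cid2.
exists (\sum_i \sum_j b i j) => [|i j].
  by apply: sumr_ge0 => i _; apply: sumr_ge0.
apply: (@lle_mono (b i j)); last by rewrite /b; case: cid2.
rewrite (bigD1 i) //= (bigD1 j) //= -addrA lerDl addr_ge0 //.
  exact: sumr_ge0.
by apply: sumr_ge0 => ? _; apply: sumr_ge0.
Qed.

Lemma mlle_trunc q m n (A : 'M[L]_(m, n)) : exists2 B : 'M[R]_(m, n),
  forall i j, B i j \in from_deg G q & mlle (q - 1) (A - map_mx toL B).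
Proof.
pose B := \matrix_(i, j) sval (cid2 (lle_trunc q (A i j))).
by exists B => i j; rewrite !mxE; case: cid2.
Qed.

Lemma to_from_deg0 q m n (A : 'M[R]_(m, n)) :
  (forall i j, A i j \in from_deg G q) -> mlle (q - 1) (map_mx toL A) -> A = 0.
Proof.
move=> hA hl; apply/matrixP => i j; rewrite mxE; apply: lle_from_deg0 (hA i j) _.
by have := hl i j; rewrite mxE.
Qed.

(** Geometric series: the k-th power of [E] has degree at most -k, so every coefficient of the
    partial sums becomes stationary. *)
Lemma mlle_inv n (E : 'M[L]_n) : mlle (-1) E ->
  exists B : 'M[L]_n, [/\ (1%:M - E) *m B = 1%:M, B *m (1%:M - E) = 1%:M & mlle 0 B].
Proof.
move=> hE; pose pw k : 'M[L]_n := iter k (mulmx E) 1%:M.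
have mlle1 : mlle 0 (1%:M : 'M[L]_n).
  move=> i j; rewrite mxE; case: (i == j); last exact: lle0.
  by rewrite -(rmorph1 toL); apply/lle_to/homog1.
have hpw k : mlle (- k%:Z) (pw k).
  elim: k => [|k IHk]; first by rewrite oppr0.
  apply: (@mlle_mono (-1 + - k%:Z)); first by lia.
  exact: mlleM.
have pwr k : pw k *m E = pw k.+1.
  by elim: k => [|k IHk]; rewrite /= ?mulmx1 ?mul1mx // -mulmxA IHk.
pose S N := \sum_(k < N) pw k.
have SD N d : mlle (- N%:Z) (S (N + d)%N - S N).
  elim: d => [|d IHd]; first by rewrite addn0 subrr => i j; rewrite mxE; apply: lle0.
  rewrite addnS /S big_ord_recr /= addrAC; apply: mlleD; first exact: IHd.
  by apply: mlle_mono (hpw _); lia.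
(* The coefficient in degree [k] is read off the partial sum with |k| + 1 terms: all later terms
   have degree at most -(|k| + 1), which is below [k]. *)
have bnd (i j : 'I_n) : (fun k => lcoef (S `|k|.+1 i j) k) \in laurent_pred G.
  apply/asboolP; split=> [k|]; first exact: lcoef_homog.
  exists 0 => k k0; have := SD 0%N (`|k|.+1) i j k.
  by rewrite /S big_ord0 subr0 add0n; apply; lia.
pose B : 'M[L]_n := \matrix_(i, j) Laurent (bnd i j).
have BS N : mlle (- N%:Z) (B - S N).
  move=> i j k hk; rewrite !mxE raddfB /= !fctE; case: (leqP N (`|k|.+1)) => hN.
    have := SD N (`|k|.+1 - N)%N i j k hk.
    by rewrite subnKC // !mxE raddfB.
  have kM : - (`|k|.+1)%:Z < k by lia.
  have := SD (`|k|.+1)%N (N - `|k|.+1)%N i j k kM.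
  rewrite subnKC 1?ltnW // !mxE raddfB /= !fctE => /eqP.
  by rewrite subr_eq0 => /eqP->; rewrite subrr.
have ES N : (1%:M - E) *m S N = 1%:M - pw N.
  elim: N => [|N IHN]; first by rewrite /S big_ord0 mulmx0 subrr.
  by rewrite /S big_ord_recr /= mulmxDr IHN mulmxBl mul1mx addrA subrK.
have SE N : S N *m (1%:M - E) = 1%:M - pw N.
  elim: N => [|N IHN]; first by rewrite /S big_ord0 mul0mx subrr.
  by rewrite /S big_ord_recr /= mulmxDl IHN mulmxBr mulmx1 pwr addrA subrK.
have h1E : mlle 0 (1%:M - E) by apply: mlleB => //; apply: mlle_mono hE.
(* Each product differs from 1 by a matrix of degree at most -N for every N, hence equals 1. *)
exists B; split.
- apply/eqP; rewrite -subr_eq0; apply/eqP/mlle_eq0 => N.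
  have -> : (1%:M - E) *m B - 1%:M = (1%:M - E) *m (B - S N) - pw N.
    by rewrite mulmxBr ES opprB -addrA addrAC addrN sub0r.
  by apply: mlleB => //; rewrite -[- _]add0r; apply: mlleM.
- apply/eqP; rewrite -subr_eq0; apply/eqP/mlle_eq0 => N.
  have -> : B *m (1%:M - E) - 1%:M = (B - S N) *m (1%:M - E) - pw N.
    by rewrite mulmxBl SE opprB -addrA addrAC addrN sub0r.
  by apply: mlleB => //; rewrite -[- _]addr0; apply: mlleM.
- by have := BS 0%N; rewrite /S big_ord0 subr0.
Qed.

Lemma omega_plus_one_sub n (A : 'M[R]_n) (E : 'M[L]_n) : (0 < n)%N ->
  map_mx toL A = 1%:M - E -> mlle (-1) E -> omega_plus G A.
Proof.
by move=> n0 AE /mlle_inv[B [EB BE _]]; split=> //; exists B; rewrite AE.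
Qed.
End Laurent.

(* A decomposition of 1 in R_n R_(-n). *)
Record unit_dec (R : pzRingType) (G : zgrading R) (n : int) := UnitDec {
  du_rk : nat;
  du : 'I_du_rk -> R;
  dv : 'I_du_rk -> R;
  du_homog : forall a, du a \in G n;
  dv_homog : forall a, dv a \in G (- n);
  du_dv : \sum_a du a * dv a = 1
}.

Arguments du {R G n} u a : rename.
Arguments dv {R G n} u a : rename.
Arguments du_homog {R G n} u a : rename.
Arguments dv_homog {R G n} u a : rename.
Arguments du_dv {R G n} u : rename.

(** A tensor sent to 1 by [mult_map] is represented by a finite list of pairs; these pairs are the
    decomposition. *)
Lemma unit_decP (R : pzRingType) (G : zgrading R) : strongly_graded G ->
  forall n, unit_dec G n.
Proof.
move=> sG n; have [t] := cid (sG n 1); rewrite -(tcls_repr t); move: (repr t) => s.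
rewrite /mult_map tlift_cls; last exact: hpart_mul_balanced.
move=> /(congr1 val); rewrite /eval_sum raddf_sum /= => s1.
exists (size s) (fun a => val (tnth (in_tuple s) a).1) (fun a => val (tnth (in_tuple s) a).2).
- by move=> a; apply: valP.
- by move=> a; apply: valP.
by rewrite -s1 (big_tnth _ _ s).
Qed.

(** * Inverting matrices and the maps mu(A, m) *)

Section StandardBasis.
Variable K : pzRingType.

Definition ffun_coord n (i : 'I_n) : {linear {ffun 'I_n -> K^c^o} -> K^c^o} :=
  sval (@mk_lin K {ffun 'I_n -> K^c^o} K^c^o (fun x => x i)
    (fun x y => ffunE _ i) (fun x a => rsc_ffun x a i)).

Lemma ffun_coordE n (i : 'I_n) x : ffun_coord i x = x i.
Proof. by rewrite /ffun_coord; case: mk_lin => g /= ->. Qed.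

Definition ffun_delta n (i : 'I_n) : {ffun 'I_n -> K^c^o} :=
  [ffun j => (j == i)%:R : K].

Fact ffun_bE n (x : {ffun 'I_n -> K^c^o}) :
  x = \sum_i rsc (ffun_delta i) (ffun_coord i x : K).
Proof.
apply/ffunP => j; rewrite sum_ffunE (bigD1 j) //= rsc_ffun ffunE eqxx ffun_coordE.
rewrite rsc_reg mul1r big1 ?addr0 // => i ij.
by rewrite rsc_ffun ffunE eq_sym (negPf ij) rsc_reg mul0r.
Qed.

Fact ffun_bK n (i j : 'I_n) : ffun_coord i (ffun_delta j) = (i == j)%:R :> K.
Proof. by rewrite ffun_coordE ffunE. Qed.

Definition ffun_basis n := Basis (@ffun_bE n) (@ffun_bK n).

(** Connects a free module with the standard one, on which [mu_map] and [lmulmx] are defined. *)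
Lemma coord_map (M : rmodType K) (b : basis M) :
  {g : {linear M -> {ffun 'I_(rk b) -> K^c^o}} |
    bijective g /\ forall x i, g x i = bco b i x}.
Proof.
have [||g gE] := @mk_lin K M {ffun 'I_(rk b) -> K^c^o} (fun x => [ffun i => bco b i x]).
- by move=> x y; apply/ffunP => i; rewrite !ffunE linearD.
- by move=> x a; apply/ffunP => i; rewrite rsc_ffun !ffunE lin_rsc.
exists g; split=> [|x i]; last by rewrite gE ffunE.
exists (fun y : {ffun 'I_(rk b) -> K^c^o} => \sum_i rsc (bv b i) (y i : K)) => [x|y].
  by rewrite [RHS](bE b); apply: eq_bigr => i _; rewrite gE ffunE.
by apply/ffunP => i; rewrite gE ffunE bco_sum.
Qed.
End StandardBasis.

Lemma mx_of_lmulmx (R : pzRingType) n (A : 'M[R]_n) :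
  mx_of (ffun_basis R n) (ffun_basis R n) (lmulmx A) = A.
Proof.
apply/matrixP => i j; rewrite mxE [LHS]ffun_coordE ffunE (bigD1 j) //= ffunE eqxx.
by rewrite mulr1 big1 ?addr0 // => k kj; rewrite ffunE (negPf kj) mulr0.
Qed.

Lemma ext_map_bij (K S : pzRingType) (f : {rmorphism K -> S}) (M N : rmodType K)
  (g : {linear M -> N}) : bijective g -> bijective (ext_map f g).
Proof.
case/lin_inv => h [gK hK]; exists (ext_map f h) => x.
  rewrite -(@ext_map_comp _ _ f _ _ _ h g idfun) => [|y]; last by rewrite /= gK.
  by move: x; apply: (@ext_eq _ _ f M _ (ext_map f idfun) idfun) => m s; rewrite /= ext_map_tp.
rewrite -(@ext_map_comp _ _ f _ _ _ g h idfun) => [|y]; last by rewrite /= hK.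
by move: x; apply: (@ext_eq _ _ f N _ (ext_map f idfun) idfun) => m s; rewrite /= ext_map_tp.
Qed.

Lemma inverts_lmulmx (R S : pzRingType) (g : {rmorphism R -> S}) n (A : 'M[R]_n) :
  bijective (ext_map g (lmulmx A)) <->
  exists B, map_mx g A *m B = 1%:M /\ B *m map_mx g A = 1%:M.
Proof.
set b := ffun_basis R n; have e := mx_of_ext g b b (lmulmx A).
rewrite mx_of_lmulmx in e; split.
  by move=> /(bij_mx_of (ext_basis g b) (ext_basis g b)); rewrite e.
by case=> B; rewrite -e => -[BA AB];
  apply: (mx_of_bij (bM := ext_basis g b) (bN := ext_basis g b) BA AB).
Qed.

Section Shift.
Variables (R : pzRingType) (G : zgrading R).
Local Notation P := (nonneg G).

Lemma from_deg_mono i j x : i <= j -> x \in from_deg G j -> x \in from_deg G i.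
Proof.
by move=> ij /from_degP h; apply/from_degP => k ki; apply: h; apply: lt_le_trans ij.
Qed.

Lemma tshift_rsc m (x : tshift G m) (a : P) : val (rsc x a) = val x * val a.
Proof. by []. Qed.

Lemma mk_tshift (U : rmodType P) n m (F : U -> 'I_n -> R) :
  (forall x i, F x i \in from_deg G (- m)) ->
  (forall x y i, F (x + y) i = F x i + F y i) ->
  (forall x (a : P) i, F (rsc x a) i = F x i * val a) ->
  {g : {linear U -> {ffun 'I_n -> tshift G m}} | forall x i, val (g x i) = F x i}.
Proof.
move=> Fm FD FZ.
have [||g gE] := @mk_lin P U {ffun 'I_n -> tshift G m} (fun x => [ffun i => TShift (Fm x i)]).
- by move=> x y; apply/ffunP => i; apply/val_inj; rewrite !ffunE /= FD.
- by move=> x a; apply/ffunP => i; apply/val_inj; rewrite rsc_ffun !ffunE tshift_rsc /= FZ.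
by exists g => x i; rewrite gE ffunE.
Qed.

Section Invert.
Variables (sG : strongly_graded G) (S : pzRingType) (g : {rmorphism R -> S}).

(* Over S the bimodule t^-m P becomes S, as R_(-m) R_m contains 1. *)
Lemma ext_tshift k m :
  {t : {linear ext_mod (g \o nonneg_val G) {ffun 'I_k -> tshift G m} ->
        {ffun 'I_k -> S^c^o}} |
    bijective t /\ forall x s i, t (tp _ x s) i = g (val (x i)) * s :> S}.
Proof.
set f := (g \o nonneg_val G : {rmorphism P -> S}).
have [||t tE0] := @ext_lin _ _ f {ffun 'I_k -> tshift G m} {ffun 'I_k -> S^c^o}
  (fun x => [ffun i => g (val (x i)) : S^c^o]).
- by move=> x y; apply/ffunP => i; rewrite !ffunE /= !rmorphD.
- by move=> x a; apply/ffunP => i; rewrite !ffunE; exact: (rmorphM g).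
have tE x s i : t (tp _ x s) i = g (val (x i)) * s :> S.
  by rewrite tE0 rsc_ffun ffunE rsc_reg.
exists t; split=> //.
have [d u v hu hv uv] := unit_decP sG (- m).
pose U a : tshift G m := TShift (homog_from_deg (hu a)).
pose e i a : {ffun 'I_k -> tshift G m} := [ffun j => if j == i then U a else 0].
(* The inverse of [t]: an entry y_i goes to the sum over a of u_a e_i (x) g(v_a) y_i, which [t]
   sends back to y_i because the u_a v_a add up to 1. *)
pose h (y : {ffun 'I_k -> S^c^o}) := \sum_i \sum_a tp f (e i a) (g (v a) * (y i : S)).
exists h => [x|y]; last first.
  apply/ffunP => j; rewrite linear_sum sum_ffunE (bigD1 j) //= [X in _ + X]big1 ?addr0.
    rewrite linear_sum sum_ffunE.
    transitivity (g (\sum_a u a * v a) * (y j : S)); last by rewrite uv rmorph1 mul1r.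
    rewrite rmorph_sum mulr_suml.
    by apply: eq_bigr => a _; rewrite tE ffunE eqxx /= rmorphM mulrA.
  move=> i ij; rewrite linear_sum sum_ffunE big1 // => a _.
  by rewrite tE ffunE eq_sym (negPf ij) /= rmorph0 mul0r.
have h0 : h 0 = 0.
  by rewrite /h big1 // => i _; rewrite big1 // => a _; rewrite ffunE mulr0 tp0r.
have hD y z : h (y + z) = h y + h z.
  rewrite /h -big_split; apply: eq_bigr => i _; rewrite -big_split; apply: eq_bigr => a _ /=.
  by rewrite -tpDr -mulrDr ffunE.
elim/ext_ind: x => [|x s z IHz]; first by rewrite linear0.
rewrite linearD hD IHz; congr (_ + _).
(* v_a has degree m and x_i lies in t^-m P, so v_a x_i lies in P and may cross the tensor sign. *)
have vP i a : v a * val (x i) \in from_deg G 0.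
  by have := from_degM (homog_from_deg (hv a)) (valP (x i)); rewrite opprK subrr.
have hE i a : tp f (e i a) (g (v a) * (t (tp f x s) i : S)) =
    tp f (rsc (e i a) (Nonneg (vP i a))) s.
  by rewrite tE mulrA -rmorphM tp_rscl.
rewrite /h; under eq_bigr do under eq_bigr do rewrite hE.
under eq_bigr do rewrite -tp_suml; rewrite -tp_suml; congr (tp f _ s).
apply/ffunP => j; rewrite sum_ffunE (bigD1 j) //= [X in _ + X]big1 ?addr0.
  apply/val_inj; rewrite sum_ffunE raddf_sum /= -[RHS]mul1r -uv mulr_suml.
  by apply: eq_bigr => a _; rewrite rsc_ffun ffunE eqxx /= mulrA.
move=> i ij; rewrite sum_ffunE big1 // => a _.
by rewrite rsc_ffun ffunE eq_sym (negPf ij) rsc0.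
Qed.

(** Through [t] on the target and the coordinates [c] on the source, the extended map becomes
    multiplication by the matrix g(A). *)
Lemma mu_map_bij k (A : 'M[R]_k) m (hA : suitable G A m) :
  (exists B, map_mx g A *m B = 1%:M /\ B *m map_mx g A = 1%:M) ->
  bijective (ext_map (g \o nonneg_val G) (mu_map hA)).
Proof.
case=> B [AB BA]; set f := (g \o nonneg_val G : {rmorphism P -> S}).
have [t [[t' tK Kt] tE]] := ext_tshift k m.
have [c [c_bij cE]] := coord_map (ext_basis f (ffun_basis P k)).
have l_bij : bijective (lmulmx (map_mx g A)).
  by apply: (mx_of_bij (B := B) (bM := ffun_basis S k) (bN := ffun_basis S k));
    rewrite mx_of_lmulmx.
have comm x : t (ext_map f (mu_map hA) x) = lmulmx (map_mx g A) (c x).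
  move: x; apply: (@ext_eq _ _ f _ _ (t \o ext_map f (mu_map hA)) (lmulmx (map_mx g A) \o c)).
  move=> x s /=; rewrite ext_map_tp; apply/ffunP => i; rewrite tE !ffunE /=.
  rewrite rmorph_sum mulr_suml; apply: eq_bigr => j _.
  by rewrite cE ext_bco !mxE rmorphM mulrA /= ffun_coordE.
apply: (@eq_bij _ _ (t' \o (lmulmx (map_mx g A) \o c))).
  by apply: bij_comp; [exists t | apply: bij_comp].
by move=> x /=; rewrite -comm tK.
Qed.
End Invert.
End Shift.

(** * Truncated contractions *)

Section Novikov.
Variables (R : pzRingType) (G : zgrading R).
Local Notation P := (nonneg G).
Local Notation L := (laurent G).
Local Notation toL := (@to_laurent R G).
Variables (C : chain_complex P) (b : forall n, basis (C n)).

Definition novikov : {rmorphism P -> L} := toL \o nonneg_val G.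
Definition dmx n : 'M[R]_(rk (b n), rk (b (n + 1))) := map_mx (nonneg_val G) (bdmx b n).

Lemma dmxK n : dmx n *m dmx (n + 1) = 0.
Proof. by rewrite -map_mxM bdmxK map_mx0. Qed.

Lemma dmx_from_deg n i j : dmx n i j \in from_deg G 0.
Proof. by rewrite mxE; exact: valP. Qed.

(** This is phi = d s + s d on [C (n + 1)]: the index is one below the degree, as for [bd]. *)
Definition null_mx (s : forall n, 'M[R]_(rk (b (n + 1)), rk (b n))) n :=
  dmx (n + 1) *m s (n + 1) + s n *m dmx n.

Lemma null_mx_d s n : dmx (n + 1) *m null_mx s (n + 1) = null_mx s n *m dmx (n + 1).
Proof.
by rewrite /null_mx mulmxDr mulmxDl !mulmxA (dmxK (n + 1)) mul0mx add0r
  -[s n *m _ *m _]mulmxA (dmxK n) mulmx0 addr0.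
Qed.

Lemma from_degE x : exists2 p, 0 <= p & x \in from_deg G (- p).
Proof.
have [s [_ hs _]] := hcoef_seq G x; exists (\sum_(i <- s) `|i|); first exact: sumr_ge0.
apply/from_degP => k hk; apply: hs; apply/negP => ks.
have : `|k| <= \sum_(i <- s) `|i| by rewrite (big_rem k) //= lerDl sumr_ge0.
lia.
Qed.

Lemma mx_from_degE m n (A : 'M[R]_(m, n)) :
  exists2 p, 0 <= p & forall i j, A i j \in from_deg G (- p).
Proof.
pose q i j := sval (cid2 (from_degE (A i j))).
have q0 i j : 0 <= q i j by rewrite /q; case: cid2.
exists (\sum_i \sum_j q i j) => [|i j].
  by apply: sumr_ge0 => i _; apply: sumr_ge0.
apply: (@from_deg_mono _ _ _ (- q i j)); last by rewrite /q; case: cid2.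
rewrite lerN2 (bigD1 i) //= (bigD1 j) //= -addrA lerDl addr_ge0 //.
  exact: sumr_ge0.
by apply: sumr_ge0 => ? _; apply: sumr_ge0.
Qed.

(** Only degrees between -N and N carry entries, and the sum of their nonnegative bounds serves all
    of them. A single [m] lets phi map into one complex t^-m C. *)
Lemma uniform_from_deg (N : nat) (s : forall n, 'M[R]_(rk (b (n + 1)), rk (b n))) :
  (forall n, N%:Z < `|n| -> rk (b n) = 0%N) ->
  exists2 m, 0 <= m & forall n i j, s n i j \in from_deg G (- m).
Proof.
move=> hN; pose q n := sval (cid2 (mx_from_degE (s n))).
have q0 n : 0 <= q n by rewrite /q; case: cid2.
exists (\sum_(n <- zrange (- N%:Z) N) q n); first exact: sumr_ge0.
move=> n i j; have [nN|nN] := ltP N%:Z `|n|; first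
  by exfalso; have := leq_ltn_trans (leq0n _) (ltn_ord j); rewrite hN.
have hn : n \in zrange (- N%:Z) N by rewrite mem_zrange; lia.
apply: (@from_deg_mono _ _ _ (- q n)); last by rewrite /q; case: cid2.
by rewrite lerN2 (big_rem n) //= lerDl sumr_ge0.
Qed.

(* Truncating the contraction over L below a sufficiently negative degree
   changes d s + s d = 1 only by terms of negative degree. *)
Lemma novikov_truncate : contractible (extend_scalars novikov C) ->
  exists s : forall n, 'M[R]_(rk (b (n + 1)), rk (b n)), forall n,
    exists2 E, map_mx toL (null_mx s n) = 1%:M - E & mlle (-1) E.
Proof.
move=> /(contractible_mxP b)[S SE].
have dE n : map_mx novikov (bdmx b n) = map_mx toL (dmx n).
  by apply/matrixP => i j; rewrite !mxE.
pose q n := sval (cid2 (mlleE (map_mx toL (dmx n)))).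
have hq n : mlle (q n) (map_mx toL (dmx n)) by rewrite /q; case: cid2.
pose s n := sval (cid2 (mlle_trunc (- q n) (S n))).
have hs n : mlle (- q n - 1) (S n - map_mx toL (s n)) by rewrite /s; case: cid2.
exists s => n; exists (map_mx toL (dmx (n + 1)) *m (S (n + 1) - map_mx toL (s (n + 1)))
   + (S n - map_mx toL (s n)) *m map_mx toL (dmx n)).
  rewrite -(SE n) !dE map_mxD !map_mxM mulmxBr mulmxBl.
  by rewrite addrACA -opprD subKr.
apply: mlleD.
  by apply: (@mlle_mono _ _ (q (n + 1) + (- q (n + 1) - 1))); [lia | apply: mlleM].
by apply: (@mlle_mono _ _ (- q n - 1 + q n)); [lia | apply: mlleM].
Qed.

(** Coordinates are taken over [R], where those of t^-m C live too ([tvec]); identities between maps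
    C -> t^-m C thus become matrix identities. *)
Definition cvec n (x : C n) : 'cV[R]_(rk (b n)) :=
  \col_j nonneg_val G (bco (b n) j x : P).

Lemma cvecD n (x y : C n) : cvec (x + y) = cvec x + cvec y.
Proof. by apply/matrixP => i j; rewrite !mxE linearD raddfD. Qed.

Lemma cvec_rsc n (x : C n) (a : P) : cvec (rsc x a) = cvec x *m (nonneg_val G a)%:M.
Proof.
apply/matrixP => i j; rewrite !mxE lin_rsc rsc_reg rmorphM big_ord1 !mxE.
by rewrite [j]ord1 eqxx.
Qed.

Lemma cvec_bd n (x : C (n + 1)) : cvec (bd C n x) = dmx n *m cvec x.
Proof.
apply/matrixP => i j; rewrite !mxE (bco_lin (b (n + 1))) rmorph_sum.
by apply: eq_bigr => k _; rewrite !mxE rmorphM.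
Qed.

Lemma cvec_from_deg n (x : C n) i j : cvec x i j \in from_deg G 0.
Proof. by rewrite mxE; exact: valP. Qed.

Definition tvec m k (x : {ffun 'I_k -> tshift G m}) : 'cV[R]_k := \col_j val (x j).

Lemma tvec_inj m k : injective (@tvec m k).
Proof.
move=> x y /matrixP xy; apply/ffunP => i; apply/val_inj.
by have := xy i 0; rewrite !mxE.
Qed.

Lemma mulmx_from_deg d e m n l (A : 'M[R]_(m, n)) (B : 'M[R]_(n, l)) :
  (forall i j, A i j \in from_deg G d) -> (forall i j, B i j \in from_deg G e) ->
  forall i j, (A *m B) i j \in from_deg G (d + e).
Proof. by move=> hA hB i j; rewrite mxE; apply: rpred_sum => k _; apply: from_degM. Qed.

Lemma tvec_lin (U : rmodType P) p m (c : U -> 'cV[R]_p) :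
  (forall x i j, c x i j \in from_deg G (- m)) ->
  (forall x y, c (x + y) = c x + c y) ->
  (forall x (a : P), c (rsc x a) = c x *m (nonneg_val G a)%:M) ->
  {g : {linear U -> {ffun 'I_p -> tshift G m}} | forall x, tvec (g x) = c x}.
Proof.
move=> cm cD cZ; have [||| g gE] := @mk_tshift R G U p m (fun x i => c x i 0).
- by move=> x i; apply: cm.
- by move=> x y i; rewrite cD mxE.
- by move=> x a i; rewrite cZ mxE big_ord1 mxE.
by exists g => x; apply/matrixP => i j; rewrite mxE gE [j]ord1.
Qed.

Lemma null_mx_from_deg (s : forall n, 'M[R]_(rk (b (n + 1)), rk (b n))) m :
  (forall n i j, s n i j \in from_deg G (- m)) ->
  forall n i j, null_mx s n i j \in from_deg G (- m).
Proof.
move=> sm n i j; rewrite mxE; apply: rpredD.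
  by have := mulmx_from_deg (@dmx_from_deg (n + 1)) (sm (n + 1)) i j; rewrite add0r.
by have := mulmx_from_deg (sm n) (@dmx_from_deg n) i j; rewrite addr0.
Qed.

Lemma contractible_omega_nonneg (N : nat) (LP : pzRingType) (iota : {rmorphism P -> LP}) :
  (forall n, N%:Z < `|n| -> rk (b n) = 0%N) ->
  inverts iota (@omega_nonneg R G) ->
  contractible (extend_scalars novikov C) -> contractible (extend_scalars iota C).
Proof.
move=> hN inv /novikov_truncate[s sE].
have [m m0 sm] := uniform_from_deg s hN.
have suit n : suitable G (null_mx s n) m by exact: null_mx_from_deg.
(* The modules of t^-m C in coordinates; [dT] below gives them the differentials of C. *)
pose T n : rmodType P := {ffun 'I_(rk (b n)) -> tshift G m}.
have h n : {g : {linear C n -> T (n + 1)} | forall x, tvec (g x) = s n *m cvec x}.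
  apply: tvec_lin => [x i j|x y|x a].
  - by have := mulmx_from_deg (sm n) (@cvec_from_deg n x) i j; rewrite addr0.
  - by rewrite cvecD mulmxDr.
  - by rewrite cvec_rsc mulmxA.
have dT n : {g : {linear T (n + 1) -> T n} | forall x, tvec (g x) = dmx n *m tvec x}.
  apply: tvec_lin => [x i j|x y|x a].
  - have xm k l : tvec x k l \in from_deg G (- m) by rewrite mxE; exact: valP.
    by have := mulmx_from_deg (@dmx_from_deg n) xm i j; rewrite add0r.
  - by rewrite -mulmxDr; congr (_ *m _); apply/matrixP => i j; rewrite !mxE ffunE.
  - rewrite -mulmxA; congr (_ *m _); apply/matrixP => i j.
    by rewrite !mxE rsc_ffun big_ord1 !mxE [j]ord1.
pose cm n := sval (coord_map (b n)).
have cmE n x i : cm n x i = bco (b n) i x.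
  by have [_] := svalP (coord_map (b n)); apply.
pose phi n : {linear C (n + 1) -> T (n + 1)} := mu_map (suit n) \o cm (n + 1).
have phiE n x : tvec (phi n x) = null_mx s n *m cvec x.
  apply/matrixP => i j; rewrite !mxE ffunE /=; apply: eq_bigr => k _.
  by rewrite cmE !mxE.
apply: (@contractible_nullhomotopic _ _ iota C T (fun n => sval (dT n))
  (fun n => sval (h n)) phi).
- move=> n x; apply: tvec_inj.
  have -> : tvec (sval (dT (n + 1)) (sval (h (n + 1)) x) + sval (h n) (bd C n x)) =
     tvec (sval (dT (n + 1)) (sval (h (n + 1)) x)) + tvec (sval (h n) (bd C n x)).
    by apply/matrixP => i j; rewrite !mxE ffunE.
  rewrite phiE (svalP (dT (n + 1))) (svalP (h (n + 1))) (svalP (h n)) cvec_bd !mulmxA.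
  by rewrite -mulmxDl.
- move=> n x; apply: tvec_inj.
  by rewrite phiE (svalP (dT (n + 1))) phiE cvec_bd !mulmxA null_mx_d.
(* Rank 0 is treated apart because [omega_plus] leaves out the empty matrix; source and target are
   then both zero. *)
move=> n; have [r0|r0] := posnP (rk (b (n + 1))).
  have triv (V : rmodType P) (x : {ffun 'I_(rk (b (n + 1))) -> V}) : x = 0.
    apply/ffunP => i; exfalso; have := leq_ltn_trans (leq0n _) (ltn_ord i).
    by rewrite r0.
  have C0 (x : C (n + 1)) : x = 0.
    by apply: (bij_inj (proj1 (svalP (coord_map (b (n + 1)))))); rewrite [LHS]triv [RHS]triv.
  exists (fun=> 0) => x; first by rewrite [RHS](ext_mod_trivial C0).
  rewrite linear0; apply/esym/ext_mod_trivial => y; exact: triv.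
have [E phiEE hE] := sE n.
apply: (@eq_bij _ _ (ext_map iota (mu_map (suit n)) \o ext_map iota (cm (n + 1)))).
  apply: bij_comp; last by apply: ext_map_bij; case: (svalP (coord_map (b (n + 1)))).
  by apply: inv; apply: OmegaNonneg; apply: omega_plus_one_sub hE.
by move=> x; rewrite /= -(@ext_map_comp _ _ iota _ _ _ _ _ (phi n)).
Qed.
End Novikov.

Lemma inverts_omega_nonneg (R S : pzRingType) (G : zgrading R) (g : {rmorphism R -> S}) :
  strongly_graded G -> inverts g (@omega_full R G) ->
  inverts (g \o nonneg_val G) (@omega_nonneg R G).
Proof.
move=> sG inv M N s [k A m hA oA]; apply: mu_map_bij => //.
by apply/inverts_lmulmx; apply: inv.
Qed.

Lemma inverts_omega_full (R : pzRingType) (G : zgrading R) :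
  inverts (@to_laurent R G) (@omega_full R G).
Proof. by move=> M N s [k A [_ oA]]; apply/inverts_lmulmx. Qed.

(** * From contractibility over Laurent series to finite domination *)

Section Domination.
Variables (R : pzRingType) (G : zgrading R).
Local Notation P := (nonneg G).
Local Notation L := (laurent G).
Local Notation toL := (@to_laurent R G).
Local Notation R0 := (deg0 G).

Definition mdeg d m n (A : 'M[R]_(m, n)) := forall i j, A i j \in from_deg G d.

Lemma mdegB d m n (A B : 'M[R]_(m, n)) : mdeg d A -> mdeg d B -> mdeg d (A - B).
Proof. by move=> hA hB i j; rewrite !mxE; apply: rpredB. Qed.

Lemma mdegD d m n (A B : 'M[R]_(m, n)) : mdeg d A -> mdeg d B -> mdeg d (A + B).
Proof. by move=> hA hB i j; rewrite !mxE; apply: rpredD. Qed.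

Lemma mdegM d e m n l (A : 'M[R]_(m, n)) (B : 'M[R]_(n, l)) :
  mdeg d A -> mdeg e B -> mdeg (d + e) (A *m B).
Proof. exact: mulmx_from_deg. Qed.

Lemma mdeg_scalar (a : R0) : mdeg 0 ((val a)%:M : 'M[R]_1).
Proof.
move=> i j; rewrite mxE; case: (i == j); last by rewrite rpred0.
exact/homog_from_deg/valP.
Qed.

Lemma mlle_scalar (a : R0) : mlle 0 (map_mx toL ((val a)%:M : 'M[R]_1)).
Proof.
move=> i j; rewrite !mxE; case: (i == j); first exact/lle_to/valP.
by rewrite rmorph0; apply: lle0.
Qed.

(** Division with remainder by [A]: quotients have entries in P, remainders only negative degrees.
    It rests on cutting off degrees, which is compatible with scalars from [R0] but not from P;
    hence [quo_rsc]. *)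
Record divider k (A : 'M[R]_k) := Divider {
  quo : 'cV[R]_k -> 'cV[R]_k;
  quo_deg : forall x, mdeg 0 (quo x);
  quoD : forall x y, quo (x + y) = quo x + quo y;
  quo_rsc : forall x (a : R0), quo (x *m (val a)%:M) = quo x *m (val a)%:M;
  rem_lt : forall x, mlle (-1) (map_mx toL (x - A *m quo x));
  quoK : forall c, mdeg 0 c -> quo (A *m c) = c
}.

(* The quotient is the part of A^-1 x in nonnegative degrees. *)
Lemma division k (A : 'M[R]_k) (E : 'M[L]_k) :
  map_mx toL A = 1%:M - E -> mlle (-1) E -> divider A.
Proof.
move=> AE hE; have [B [EB BE _]] := cid (mlle_inv hE); rewrite -AE in EB BE.
have hA : mlle 0 (map_mx toL A).
  rewrite AE; apply: mlleB; last exact: mlle_mono hE.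
  move=> i j; rewrite mxE; case: (i == j); last exact: lle0.
  by rewrite -(rmorph1 toL); apply/lle_to/homog1.
have tr x : exists2 y : 'cV[R]_k, mdeg 0 y & mlle (-1) (B *m map_mx toL x - map_mx toL y).
  by have [y hy hl] := mlle_trunc 0 (B *m map_mx toL x); exists y.
pose th x := sval (cid2 (tr x)).
have th0 x : mdeg 0 (th x) by rewrite /th; case: cid2.
have thE x : mlle (-1) (B *m map_mx toL x - map_mx toL (th x)) by rewrite /th; case: cid2.
(* Uniqueness of the truncation; additivity, [R0]-linearity and [quoK] all follow from it. *)
have thU x y : mdeg 0 y -> mlle (-1) (B *m map_mx toL x - map_mx toL y) -> th x = y.
  move=> y0 hy; apply/eqP; rewrite -subr_eq0; apply/eqP.
  apply: (@to_from_deg0 _ G 0); first exact: mdegB.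
  by have := mlleB hy (thE x); rewrite opprB addrC addrA subrK -map_mxB.
exists th => //.
- move=> x y; apply: thU; first exact: mdegD.
  by rewrite !map_mxD mulmxDr opprD addrACA; apply: mlleD.
- move=> x a; apply: thU; first by have := mdegM (th0 x) (mdeg_scalar a); rewrite addr0.
  rewrite !map_mxM mulmxA -mulmxBl.
  by have := mlleM (thE x) (mlle_scalar a); rewrite addr0.
- move=> x; rewrite map_mxB map_mxM.
  have -> : map_mx toL x - map_mx toL A *m map_mx toL (th x)
      = map_mx toL A *m (B *m map_mx toL x - map_mx toL (th x)).
    by rewrite mulmxBr mulmxA EB mul1mx.
  by have := mlleM hA (thE x); rewrite add0r.
- move=> c c0; apply: thU => //.
  by rewrite map_mxM mulmxA BE mul1mx subrr => i j; rewrite mxE; apply: lle0.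
Qed.

Lemma hcoef_window (q : nat) x : x \in from_deg G (- q%:Z) -> lle (-1) (toL x) ->
  x = \sum_(j < q) hcoef G x (- j.+1%:Z).
Proof.
move=> /from_degP hx hl; have [_ _ {1}->] := hcoefP G x.
rewrite (@sum_allE _ _ [seq - j.+1%:Z | j <- iota 0 q]).
- by rewrite big_map -{1}[q]subn0 -/(index_iota 0 q) big_mkord.
- by rewrite map_inj_uniq ?iota_uniq // => i j; lia.
move=> k /mapP hk; have [kq|kq] := ltP k (- q%:Z); first exact: hx.
have [k0|k0] := ltP (-1) k; first exact: hl.
by case: hk; exists `|k|.-1%N; rewrite ?mem_iota; lia.
Qed.

(* A retraction of a free R_0-module onto the degree window [-q, -1] of R^k. *)
Record window (q k : nat) := Window {
  wrk : nat;
  wto : 'cV[R]_k -> {ffun 'I_wrk -> R0^c^o};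
  wof : {ffun 'I_wrk -> R0^c^o} -> 'cV[R]_k;
  wtoD : forall x y, wto (x + y) = wto x + wto y;
  wto_rsc : forall x (a : R0), wto (x *m (val a)%:M) = rsc (wto x) a;
  wofD : forall x y, wof (x + y) = wof x + wof y;
  wof_rsc : forall x (a : R0), wof (rsc x a) = wof x *m (val a)%:M;
  wof_deg : forall c, mdeg (- q%:Z) (wof c);
  wtoK : forall x, mdeg (- q%:Z) x -> mlle (-1) (map_mx toL x) -> wof (wto x) = x;
  wrk0 : k = 0%N -> wrk = 0%N
}.

(** Let the u_a of degree -(j+1) and the v_a of degree j+1 satisfy sum u_a v_a = 1. Then x |-> (v_a
    x) embeds the part of degree -(j+1) into a free [R0]-module, and (c_a) |-> sum u_a c_a is a
    retraction. *)
Lemma window_exists (q k : nat) : strongly_graded G -> window q k.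
Proof.
move=> sG; pose dec (j : nat) := unit_decP sG (- j.+1%:Z).
pose N j := du_rk (dec j); pose u j := du (dec j); pose v j := dv (dec j).
have uP j a : u j a \in G (- j.+1%:Z) := du_homog (dec j) a.
have vP j a : v j a \in G j.+1%:Z.
  by have := dv_homog (dec j) a; rewrite [- - _]opprK.
have uv j : \sum_a u j a * v j a = 1 := du_dv (dec j).
(* An index is a coordinate of the column, a degree [- j.+1] of the window and a term of the
   decomposition of 1 there. *)
pose T : finType := ('I_k * {j : 'I_q & 'I_(N j)})%type.
have alP (x : 'cV[R]_k) (t : T) :
    v (tag t.2) (tagged t.2) * hcoef G (x t.1 0) (- (tag t.2).+1%:Z) \in G 0.
  by have := homogM (vP _ (tagged t.2))
    (hcoef_homog G (x t.1 0) (- (tag t.2).+1%:Z)); rewrite subrr.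
pose ev (b : 'I_#|T|) : T := enum_val b.
pose al (x : 'cV[R]_k) : {ffun 'I_#|T| -> R0^c^o} := [ffun b => Deg0 (alP x (ev b))].
pose be (c : {ffun 'I_#|T| -> R0^c^o}) : 'cV[R]_k :=
  \col_i \sum_(b | (ev b).1 == i) u (tag (ev b).2) (tagged (ev b).2) * val (c b : R0).
exists #|T| al be.
- move=> x y; apply/ffunP => b; rewrite !ffunE; apply/val_inj => /=.
  by rewrite mxE hcoefD mulrDr.
- move=> x a; apply/ffunP => b; rewrite rsc_ffun !ffunE; apply/val_inj => /=.
  by rewrite mxE big_ord1 mxE (hcoefMr _ _ (valP a)) subr0 mulrA.
- move=> x y; apply/matrixP => i j; rewrite !mxE -big_split.
  by apply: eq_bigr => b _; rewrite ffunE raddfD mulrDr.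
- move=> x a; apply/matrixP => i j; rewrite !mxE.
  rewrite big_ord1 !mxE [j]ord1 mulr_suml; apply: eq_bigr => b _.
  by rewrite rsc_ffun rsc_reg /= mulrA.
- move=> c i j; rewrite mxE; apply: rpred_sum => b _.
  have := homogM (uP _ (tagged (ev b).2)) (valP (c b : R0)); rewrite addr0.
  move=> /homog_from_deg; apply: from_deg_mono; rewrite lerN2.
  by have := ltn_ord (tag (ev b).2); lia.
- move=> x xq xl; apply/matrixP => i j; rewrite mxE [j]ord1.
  have xi := xl i 0; rewrite mxE in xi.
  rewrite [RHS](hcoef_window (xq i 0) xi).
  rewrite (reindex (@enum_rank T)) /=; last exact/onW_bij/enum_rank_bij.
  pose F (i' : 'I_k) (w : {j : 'I_q & 'I_(N j)}) := u (tag w) (tagged w) *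
    (v (tag w) (tagged w) * hcoef G (x i' 0) (- (tag w).+1%:Z)).
  transitivity (\sum_(t : T | (t.1 == i) && true) F t.1 t.2).
    by apply: eq_big => [t|t _]; rewrite ?ffunE /ev /= enum_rankK ?andbT.
  rewrite -(pair_big (fun i' => i' == i) predT F) big_pred1_eq.
  transitivity (\sum_(j' < q) \sum_(a < N j') F i (Tagged (fun j' : 'I_q => 'I_(N j')) a)).
    rewrite (sig_big_dep _ _ (fun j' a => F i (Tagged (fun j' : 'I_q => 'I_(N j')) a))).
    by apply: eq_bigr => -[].
  apply: eq_bigr => j' _; rewrite -[RHS]mul1r -(uv j') mulr_suml.
  by apply: eq_bigr => a _; rewrite /F /= mulrA.
- by move=> k0; subst k; rewrite card_prod card_ord mul0n.
Qed.
End Domination.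

Section NovikovDominated.
Variables (R : pzRingType) (G : zgrading R).
Local Notation P := (nonneg G).
Local Notation L := (laurent G).
Local Notation toL := (@to_laurent R G).
Local Notation R0 := (deg0 G).
Variables (C : chain_complex P) (b : forall n, basis (C n)).
Local Notation d := (dmx b).

Lemma cvec_inj n : injective (@cvec R G C b n).
Proof.
move=> x y /matrixP xy; apply: (bco_inj (b := b n)) => i; apply/val_inj.
by have := xy i 0; rewrite !mxE.
Qed.

Lemma cvec_surj n (y : 'cV[R]_(rk (b n))) : mdeg G 0 y -> exists x, cvec b x = y.
Proof.
move=> hy; exists (\sum_j rsc (bv (b n) j) (Nonneg (hy j 0))).
by apply/matrixP => i j; rewrite mxE bco_sum [j]ord1.
Qed.

Lemma cvecN n (x : C n) : cvec b (- x) = - cvec b x.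
Proof. by apply/matrixP => i j; rewrite !mxE linearN raddfN. Qed.

(** Reindexes phi by its degree; every degree is [n + 1] for exactly one [n], and the transport
    records which. *)
Lemma null_mx_all (s : forall n, 'M[R]_(rk (b (n + 1)), rk (b n))) :
  exists phi : forall n, 'M[R]_(rk (b n)), forall n, phi (n + 1) = null_mx s n.
Proof.
have ex m : exists A : 'M[R]_(rk (b m)), forall n (e : n + 1 = m),
    A = eq_rect _ (fun j => 'M[R]_(rk (b j))) (null_mx s n) _ e.
  have [n ->] : exists n, m = n + 1 by exists (m - 1); rewrite subrK.
  exists (null_mx s n) => n' e; have e' := addIr _ e; subst n'.
  by rewrite (Prop_irrelevance e erefl).
exists (fun m => sval (cid (ex m))) => n.
exact: (svalP (cid (ex (n + 1))) n erefl).
Qed.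

(** Let theta and rho be quotient and remainder under division by phi. The dominating complex models
    t^-m C / phi(C), shifted by one: [F n] is the free module of the window in degree [n + 1], with
    differential -rho d up to [al] and [be]. The maps are i = rho s and r = theta d, the latter
    being the connecting map of 0 -> C -> t^-m C -> t^-m C / phi(C) -> 0. From d s + s d = phi
    follows r i - 1 = -(d theta s + theta s d). *)
Lemma novikov_finitely_dominated (N : nat) : strongly_graded G ->
  (forall n, N%:Z < `|n| -> rk (b n) = 0%N) ->
  contractible (extend_scalars (novikov G) C) ->
  finitely_dominated (restrict_scalars (deg0_nonneg G) C).
Proof.
move=> sG hN /(novikov_truncate b)[s sE].
have [m m0 sm] := uniform_from_deg s hN.
have [phi phiS] := null_mx_all s.
pose q := `|m|%N; have qm : - m = - q%:Z by rewrite /q; lia.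
have phim n : mdeg G (- q%:Z) (phi n).
  have [n' ->] : exists n', n = n' + 1 by exists (n - 1); rewrite subrK.
  by rewrite phiS -qm; apply: null_mx_from_deg.
have sq n : mdeg G (- q%:Z) (s n) by rewrite -qm; apply: sm.
have dphi n : d n *m phi (n + 1) = phi n *m d n.
  have [n' ->] : exists n', n = n' + 1 by exists (n - 1); rewrite subrK.
  by rewrite !phiS null_mx_d.
have divi n : divider G (phi n).
  (* A divider is data, whereas the form [n' + 1] of the degree is only known propositionally. *)
  apply: inhabited_witness.
  have [n' ->] : exists n', n = n' + 1 by exists (n - 1); rewrite subrK.
  by rewrite phiS; have [E EE hE] := sE n'; constructor; apply: division EE hE.
pose th n := quo (divi n).
have th0 n x : mdeg G 0 (th n x) := quo_deg (divi n) x.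
have thD n x y : th n (x + y) = th n x + th n y := quoD (divi n) x y.
have thZ n x (a : R0) : th n (x *m (val a)%:M) = th n x *m (val a)%:M := quo_rsc (divi n) x a.
have thl n x : mlle (-1) (map_mx toL (x - phi n *m th n x)) := rem_lt (divi n) x.
have thK n c : mdeg G 0 c -> th n (phi n *m c) = c := @quoK _ _ _ _ (divi n) c.
pose rho n x := x - phi n *m th n x.
have rhoD n x y : rho n (x + y) = rho n x + rho n y.
  by rewrite /rho thD mulmxDr opprD addrACA.
have rhoZ n x (a : R0) : rho n (x *m (val a)%:M) = rho n x *m (val a)%:M.
  by rewrite /rho thZ mulmxA mulmxBl.
have rhoK n c : mdeg G 0 c -> rho n (phi n *m c) = 0.
  by move=> c0; rewrite /rho thK // subrr.
have rhoq n x : mdeg G (- q%:Z) x -> mdeg G (- q%:Z) (rho n x).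
  by move=> hx; apply: mdegB => //; have := mdegM (phim n) (th0 n x); rewrite addr0.
pose win n := @window_exists R G q (rk (b n)) sG.
pose l n := wrk (win n).
pose al n : 'cV[R]_(rk (b n)) -> {ffun 'I_(l n) -> R0^c^o} := @wto _ _ _ _ (win n).
pose be n : {ffun 'I_(l n) -> R0^c^o} -> 'cV[R]_(rk (b n)) := @wof _ _ _ _ (win n).
have alD n x y : al n (x + y) = al n x + al n y := @wtoD _ _ _ _ (win n) x y.
have alZ n x (a : R0) : al n (x *m (val a)%:M) = rsc (al n x) a := @wto_rsc _ _ _ _ (win n) x a.
have beD n x y : be n (x + y) = be n x + be n y := @wofD _ _ _ _ (win n) x y.
have beZ n x (a : R0) : be n (rsc x a) = be n x *m (val a)%:M := @wof_rsc _ _ _ _ (win n) x a.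
have beq n c : mdeg G (- q%:Z) (be n c) := @wof_deg _ _ _ _ (win n) c.
have alK n x : mdeg G (- q%:Z) x -> mlle (-1) (map_mx toL x) -> be n (al n x) = x :=
  @wtoK _ _ _ _ (win n) x.
have l0 n : (rk (b n) = 0 -> l n = 0)%N := @wrk0 _ _ _ _ (win n).
clearbody al be; clearbody l; clear win; clearbody th; clear divi.
have dq n k (x : 'M_(_, k)) : mdeg G (- q%:Z) x -> mdeg G (- q%:Z) (d n *m x).
  by move=> hx; have := mdegM (@dmx_from_deg _ _ _ b n) hx; rewrite add0r.
have beal n x : mdeg G (- q%:Z) x -> be n (al n (rho n x)) = rho n x.
  by move=> hx; apply: alK; [apply: rhoq | apply: thl].
pose RC := restrict_scalars (deg0_nonneg G) C.
have cvZ n (x : RC n) (a : R0) : cvec b (rsc x a : RC n) = cvec b (x : C n) *m (val a)%:M.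
  exact: cvec_rsc.
have cv0 n (x : C n) : mdeg G 0 (cvec b x) by move=> i j; apply: cvec_from_deg.
have scv n (x : C n) : mdeg G (- q%:Z) (s n *m cvec b x).
  by have := mdegM (sq n) (cv0 n x); rewrite addr0.
have th_ex n (y : 'cV[R]_(rk (b n))) : exists x : C n, cvec b x = th n y.
  exact: cvec_surj.
pose thc n y := sval (cid (th_ex n y)).
have thcE n y : cvec b (thc n y) = th n y by exact: (svalP (cid (th_ex n y))).
pose F n : rmodType R0 := {ffun 'I_(l (n + 1)) -> R0^c^o}.
have bdF n : {g : {linear F (n + 1) -> F n} | forall c,
    g c = - al (n + 1) (rho (n + 1) (d (n + 1) *m be (n + 1 + 1) c))}.
  apply: mk_lin => [x y|x a]; first by rewrite beD mulmxDr rhoD alD opprD.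
  by rewrite beZ mulmxA rhoZ alZ rscNl.
have iF n : {g : {linear RC n -> F n} | forall x : C n,
    g x = al (n + 1) (rho (n + 1) (s n *m cvec b x))}.
  apply: mk_lin => [x y|x a]; first by rewrite cvecD mulmxDr rhoD alD.
  by rewrite cvZ mulmxA rhoZ alZ.
have rF n : {g : {linear F n -> RC n} | forall c, g c = thc n (d n *m be (n + 1) c)}.
  apply: mk_lin => [x y|x a]; apply: (@cvec_inj n).
    by rewrite [RHS]cvecD !thcE beD mulmxDr thD.
  by rewrite cvZ !thcE beZ mulmxA thZ.
have hF n : {g : {linear RC n -> RC (n + 1)} | forall x : C n,
    g x = - thc (n + 1) (s n *m cvec b x)}.
  apply: mk_lin => [x y|x a].
    rewrite -opprD; congr (- _); apply: (@cvec_inj (n + 1)).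
    by rewrite [RHS]cvecD !thcE cvecD mulmxDr thD.
  rewrite rscNl; congr (- _); apply: (@cvec_inj (n + 1)).
  by rewrite [RHS]cvZ cvZ !thcE mulmxA thZ.
have al0 n : al n 0 = 0 by apply: (@addrI _ (al n 0)); rewrite -alD !addr0.
have alN n x : al n (- x) = - al n x.
  by apply: (@addrI _ (al n x)); rewrite -alD !subrr al0.
have be0 n : be n 0 = 0 by apply: (@addrI _ (be n 0)); rewrite -beD !addr0.
have beN n x : be n (- x) = - be n x.
  by apply: (@addrI _ (be n x)); rewrite -beD !subrr be0.
have thz n : th n 0 = 0 by apply: (@addrI _ (th n 0)); rewrite -thD !addr0.
have thN n x : th n (- x) = - th n x.
  by apply: (@addrI _ (th n x)); rewrite -thD !subrr thz.
have rhoN n x : rho n (- x) = - rho n x by rewrite /rho thN mulmxN -opprD.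
have dth n x : mdeg G 0 (d n *m th (n + 1) x).
  by have := mdegM (@dmx_from_deg _ _ _ b n) (th0 (n + 1) x); rewrite addr0.
(* Before d, rho may be dropped up to phi applied to d theta x; rho kills this error and theta
   returns it. *)
have drho n x : d n *m rho (n + 1) x = d n *m x - phi n *m (d n *m th (n + 1) x).
  by rewrite /rho mulmxBr !mulmxA dphi.
have rdr n x : rho n (d n *m rho (n + 1) x) = rho n (d n *m x).
  by rewrite drho rhoD rhoN rhoK // oppr0 addr0.
have tdr n x : th n (d n *m rho (n + 1) x) = th n (d n *m x) - d n *m th (n + 1) x.
  by rewrite drho thD thN thK.
have FK n x : sval (bdF n) (sval (bdF (n + 1)) x) = 0.
  rewrite (svalP (bdF n)) (svalP (bdF (n + 1))) beN mulmxN rhoN alN opprK beal;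
    last by apply: dq; apply: beq.
  by rewrite rdr mulmxA dmxK mul0mx /rho thz mulmx0 subrr al0.
have sdcv n (x : C (n + 1)) : s n *m cvec b (bd C n x) =
    phi (n + 1) *m cvec b x - d (n + 1) *m (s (n + 1) *m cvec b x).
  by rewrite cvec_bd phiS /null_mx mulmxDl !mulmxA addrAC subrr add0r.
exists (ChainComplex FK); split.
(* The bound grows by one because [F n] sits over degree [n + 1]. *)
- exists N.+1 => n nN x; apply/ffunP => i; exfalso.
  have := leq_ltn_trans (leq0n _) (ltn_ord i); rewrite l0 //.
  by apply: hN; lia.
- move=> n; exists (l (n + 1)); exists idfun; exact: inv_bij.
exists (fun n => sval (iF n)), (fun n => sval (rF n)); split.
- move=> n x; rewrite (svalP (iF n)) [RHS](svalP (bdF n)) (svalP (iF (n + 1))).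
  rewrite beal // rdr -alN -rhoN; congr (al _ _).
  by rewrite sdcv rhoD rhoK // add0r.
- move=> n c; apply: (@cvec_inj n).
  rewrite (svalP (rF n)) (svalP (bdF n)) [in RHS](svalP (rF (n + 1))) [RHS]cvec_bd !thcE.
  rewrite beN beal; last by apply: dq; apply: beq.
  by rewrite mulmxN thN tdr mulmxA dmxK mul0mx thz opprB subr0.
exists (fun n => sval (hF n)) => n x; apply: (@cvec_inj (n + 1)).
rewrite [RHS]cvecD [X in _ = X + _]cvec_bd.
rewrite [sval (hF (n + 1)) x](svalP (hF (n + 1))) [sval (hF n) _](svalP (hF n)).
rewrite -[LHS]/(cvec b
  ((sval (rF (n + 1)) (sval (iF (n + 1)) x) : C (n + 1)) - (x : C (n + 1)))).
rewrite cvecD !cvecN (svalP (rF (n + 1))) (svalP (iF (n + 1))) !thcE.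
rewrite beal // tdr [bd _ n x](erefl : _ = bd C n x :> C n) sdcv thD thN thK // mulmxN opprB.
by rewrite addrAC [LHS]addrC.
Qed.
End NovikovDominated.

(** * From finite domination to contractibility over Laurent series *)

Section Resolution.
Variables (R : pzRingType) (G : zgrading R).
Local Notation P := (nonneg G).
Local Notation L := (laurent G).
Local Notation toL := (@to_laurent R G).
Local Notation R0 := (deg0 G).
Local Notation inc := (deg0_nonneg G).

Definition novikov0 : {rmorphism R0 -> L} := toL \o (@deg0_val R G).

Lemma homog_nonneg (q : nat) x : x \in G q%:Z -> x \in from_deg G 0.
Proof. by move=> /homog_from_deg; apply: from_deg_mono. Qed.

Variable dc : unit_dec G 1.
Local Notation u a := (Nonneg (homog_nonneg (du_homog dc a))).
Local Notation v a := (dv dc a).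

Section Module.
Variable N : rmodType P.
Local Notation X := (ext_mod novikov0 (rrestr inc N)).
Local Notation M := (ext_mod (novikov G) N).
Local Notation tpX := (@tp _ _ novikov0 (rrestr inc N)).
Local Notation tpM := (@tp _ _ (novikov G) N).

Lemma rrestr_rsc (c : N) (a : R0) :
  rsc (c : rrestr inc N) a = rsc c (inc a).
Proof. by []. Qed.

Fact proj_subproof : {g : {linear X -> M} | forall c x, g (tpX c x) = tpM c x}.
Proof.
have [||g gE] := @ext_lin _ _ novikov0 (rrestr inc N) M (fun c => tpM c 1).
- by move=> x y; exact: tpDl.
- by move=> x a; rewrite rrestr_rsc tp_rscl tp_rscr mulr1 mul1r.
by exists g => c x; rewrite gE -tp1.
Qed.
Definition proj := sval proj_subproof.
Lemma projE c x : proj (tpX c x) = tpM c x.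
Proof. exact: (svalP proj_subproof). Qed.

Fact shift_subproof : {g : {linear X -> X} | forall c x,
  g (tpX c x) = \sum_a tpX (rsc (c : N) (u a)) (toL (v a) * x)}.
Proof.
have [||g gE] := @ext_lin _ _ novikov0 (rrestr inc N) X
   (fun c => \sum_a tpX (rsc (c : N) (u a)) (toL (v a))).
- move=> x y; rewrite -big_split; apply: eq_bigr => a _ /=.
  by rewrite -tpDl; congr tp; exact: (@rscDl P N x y (u a)).
- move=> c r.
  (* Compatibility with r in R_0: r u_a is the sum over a' of u_a' (v_a' r u_a), whose bracket lies
     in R_0 and crosses the tensor sign; summing u_a v_a over a then leaves v_a' r. *)
  have wP a a' : v a * val r * val (u a') \in G 0.
    have := homogM (homogM (dv_homog dc a) (valP r)) (du_homog dc a').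
    by rewrite addr0 addNr.
  pose w a a' : R0 := Deg0 (wP a a').
  have e a : tpX (rsc (rsc (c : N) (inc r)) (u a)) (toL (v a)) =
     \sum_a' tpX (rsc (c : N) (u a')) (toL (v a' * val r * val (u a) * v a)).
    have -> : rsc (rsc (c : N) (inc r)) (u a) =
        \sum_a' rsc (rsc (c : N) (u a')) (inc (w a' a)).
      under eq_bigr do rewrite rscA; rewrite -rsc_sumr rscA; congr rsc.
      apply/val_inj; rewrite raddf_sum /= -[in LHS](mul1r (val r)) -(du_dv dc) !mulr_suml.
      by apply: eq_bigr => a' _ /=; rewrite !mulrA.
    rewrite [LHS]tp_suml; apply: eq_bigr => a' _.
    rewrite -rrestr_rsc tp_rscl; congr (tpX _ _).
    exact: (esym (rmorphM toL (v a' * val r * val (u a)) (v a))).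
  rewrite rrestr_rsc; under eq_bigr do rewrite e.
  rewrite exchange_big /= rsc_suml; apply: eq_bigr => a _.
  rewrite tp_rscr -rmorphM -tp_sumr -rmorph_sum; congr (tpX _ (toL _)).
  by under eq_bigr do rewrite -!mulrA; rewrite -!mulr_sumr du_dv mulr1.
by exists g => c x; rewrite gE rsc_suml; apply: eq_bigr => a _; rewrite tp_rscr.
Qed.
Definition shift := sval shift_subproof.
Lemma shiftE c x : shift (tpX c x) = \sum_a tpX (rsc (c : N) (u a)) (toL (v a) * x).
Proof. exact: (svalP shift_subproof). Qed.

Lemma proj_shift x : proj (shift x) = proj x.
Proof.
move: x; apply: (@ext_eq _ _ _ _ _ (proj \o shift) proj) => c x /=.
rewrite shiftE linear_sum projE -{2}[x]mul1r -(rmorph1 toL) -(du_dv dc) rmorph_sum.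
rewrite mulr_suml tp_sumr; apply: eq_bigr => a _.
by rewrite projE tp_rscl rmorphM mulrA.
Qed.

Definition shift_image x := exists y, x = y - shift y.

Lemma shift_imageD x y : shift_image x -> shift_image y -> shift_image (x + y).
Proof. by move=> [x' ->] [y' ->]; exists (x' + y'); rewrite linearD opprD addrACA. Qed.

Lemma shift_image_sum (I : Type) (r : seq I) (F : I -> X) :
  (forall i, shift_image (F i)) -> shift_image (\sum_(i <- r) F i).
Proof.
move=> hF; elim/big_rec: _ => [|i x _]; first by exists 0; rewrite linear0 subrr.
exact: shift_imageD.
Qed.

(** Induction on the degree: write p as the sum of u_a w_a with w_a = v_a p of degree one less.
    Modulo the image of 1 - [shift], c p (x) 1 is the sum of the c u_a (x) w_a, which is [shift] of
    c (x) p, hence congruent to c (x) p. *)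
Lemma shift_image_homog (q : nat) (c : N) (p : P) : val p \in G q%:Z ->
  shift_image (tpX (rsc c p) 1 - tpX c (novikov G p)).
Proof.
elim: q c p => [|q IHq] c p hp.
  have -> : p = inc (Deg0 hp) by exact: val_inj.
  rewrite -rrestr_rsc tp_rscl mulr1 subrr; exists 0; by rewrite linear0 subrr.
have wP a : v a * val p \in G q%:Z.
  by have := homogM (dv_homog dc a) hp; rewrite -[q.+1]add1n PoszD addKr.
pose w a : P := Nonneg (homog_nonneg (wP a)).
have pE : p = \sum_a u a * w a.
  apply/val_inj; rewrite raddf_sum /= -[LHS]mul1r -(du_dv dc) mulr_suml.
  by apply: eq_bigr => a _; rewrite mulrA.
have -> : tpX (rsc c p) 1 - tpX c (novikov G p) =
    \sum_a (tpX (rsc (rsc c (u a)) (w a)) 1 - tpX (rsc c (u a)) (novikov G (w a)))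
    + (- tpX c (novikov G p) - shift (- tpX c (novikov G p))).
  rewrite linearN opprK sumrB shiftE.
  have -> : tpX (rsc c p) 1 = \sum_a tpX (rsc (rsc c (u a)) (w a)) 1.
    by rewrite -tp_suml {1}pE rsc_sumr; congr (tpX _ _); apply: eq_bigr => a _; rewrite rscA.
  rewrite [RHS]addrCA addrC; congr (_ + _); rewrite -addrA -[LHS]addr0; congr (_ + _).
  apply/esym/eqP; rewrite addrC subr_eq0; apply/eqP/eq_bigr => a _.
  by rewrite -rmorphM.
by apply: shift_imageD; [apply: shift_image_sum => a; apply: IHq; exact: wP |
  exists (- tpX c (novikov G p))].
Qed.

Lemma shift_image_tp (c : N) (p : P) :
  shift_image (tpX (rsc c p) 1 - tpX c (novikov G p)).
Proof.
have [s [_ _ ps]] := hcoef_seq G (val p).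
have cP k : hcoef G (val p) k \in from_deg G 0.
  have [k0|k0] := ltP k 0; last first.
    by have := hcoef_homog G (val p) k; rewrite -(gez0_abs k0); apply: homog_nonneg.
  by have /from_degP -> := valP p; rewrite ?rpred0.
have pE : p = \sum_(k <- s) Nonneg (cP k) by apply/val_inj; rewrite raddf_sum.
rewrite [X in rsc c X]pE [X in novikov G X]pE rsc_sumr rmorph_sum tp_suml tp_sumr -sumrB.
apply: shift_image_sum => k.
have [k0|k0] := ltP k 0; last first.
  by apply: (@shift_image_homog `|k|%N); rewrite gez0_abs // hcoef_homog.
have -> : Nonneg (cP k) = 0.
  by apply/val_inj; have /from_degP h := valP p; exact: h.
by rewrite rscr0 rmorph0 tp0r tp0l subrr; exists 0; rewrite linear0 subrr.
Qed.

Variable b : basis N.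

(** A section of [proj]. It depends on the basis and need not commute with differentials;
    [lift_defect] measures the failure. *)
Definition blift : {linear M -> X} :=
  sval (@basis_fun _ _ _ (ext_basis (novikov G) b) (fun i => tpX (bv b i) 1)).

Lemma bliftE i x : blift (tpM (bv b i) x) = tpX (bv b i) x.
Proof.
rewrite tp1 lin_rsc -(@ext_bv _ _ (novikov G) _ b i) /blift; case: basis_fun => g /= ->.
by rewrite -tp1.
Qed.

Lemma bliftK z : proj (blift z) = z.
Proof.
move: z; apply: (@basis_ext _ _ _ (ext_basis (novikov G) b) (proj \o blift) idfun) => i /=.
by rewrite bliftE projE.
Qed.

Lemma blift_tp c : shift_image (tpX c 1 - blift (tpM c 1)).
Proof.
rewrite (bE b c) !tp_suml linear_sum -sumrB; apply: shift_image_sum => i.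
by rewrite tp_rscl mulr1 bliftE; apply: shift_image_tp.
Qed.

(** The part of degree [q] of the i-th coordinate; it passes to tensors over R_0 because scalars
    from R_0 preserve degrees. *)
Fact coef_subproof i (q : int) : {g : {linear X -> L^c^o} | forall c x,
  g (tpX c x) = toL (hcoef G (nonneg_val G (bco b i c : P)) q) * x :> L}.
Proof.
apply: (@ext_lin _ _ novikov0 (rrestr inc N) L^c^o
  (fun c => toL (hcoef G (nonneg_val G (bco b i c : P)) q))).
- by move=> x y; rewrite [bco b i _]linearD raddfD hcoefD rmorphD.
- move=> x a; rewrite rrestr_rsc lin_rsc !rsc_reg rmorphM.
  by rewrite (hcoefMr _ _ (valP a)) subr0 rmorphM.
Qed.
Definition coef i q := sval (coef_subproof i q).
Lemma coefE i q c x :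
  coef i q (tpX c x) = toL (hcoef G (nonneg_val G (bco b i c : P)) q) * x :> L.
Proof. exact: (svalP (coef_subproof i q)). Qed.

Lemma coef_shift i q x : coef i q (shift x) = coef i (q - 1) x.
Proof.
move: x; apply: (@ext_eq _ _ _ _ _ (coef i q \o shift) (coef i (q - 1))) => c x /=.
rewrite shiftE linear_sum coefE.
transitivity (\sum_a
    toL (hcoef G (nonneg_val G (bco b i c : P)) (q - 1) * (du dc a * v a)) * x).
  apply: eq_bigr => a _; rewrite coefE lin_rsc rsc_reg rmorphM (hcoefMr _ _ (du_homog dc a)).
  by rewrite !rmorphM !mulrA.
by rewrite -mulr_suml -rmorph_sum -mulr_sumr du_dv mulr1.
Qed.

Lemma coef_neg i q x : q < 0 -> coef i q x = 0.
Proof.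
move=> q0; move: x; apply: (@ext_eq _ _ _ _ _ (coef i q) \0) => c x.
rewrite /= coefE; have /from_degP h := valP (bco b i c : P).
by rewrite h // rmorph0 mul0r.
Qed.

(** An element is rebuilt from its coefficients: a homogeneous h of degree q is the sum of u_a (v_a
    h), and v_a h lies in R_0, hence can move to the second factor. *)
Lemma coef_inj (dec : forall n, unit_dec G n) x : (forall i q, coef i q x = 0) -> x = 0.
Proof.
pose ud (q : nat) a : P := Nonneg (homog_nonneg (du_homog (dec q) a)).
pose term (i : 'I_(rk b)) (q : nat) x := \sum_a tpX (rsc (bv b i) (ud q a))
  (toL (dv (dec q) a) * (coef i q%:Z x : L)).
have termD i q y z : term i q (y + z) = term i q y + term i q z.
  rewrite /term -big_split; apply: eq_bigr => a _ /=.
  by rewrite -tpDr -mulrDr linearD.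
(* The formula is claimed for all large [Q'], so that the bounds of two summands can be merged by a
   maximum. *)
have rec : exists Q : nat, forall Q', (Q <= Q')%N ->
    x = \sum_i \sum_(q < Q') term i q x.
  elim/ext_ind: x => [|c y z [Qz IHz]].
    exists 0%N => Q _; rewrite big1 // => i _; rewrite big1 // => q _.
    by rewrite /term big1 // => a _; rewrite linear0 mulr0 tp0r.
  have [Q hQ] : exists Q : nat, forall Q', (Q <= Q')%N -> forall i,
      nonneg_val G (bco b i c : P) = \sum_(q < Q') hcoef G (nonneg_val G (bco b i c : P)) q%:Z.
    pose p i := nonneg_val G (bco b i c : P).
    have ex i : exists Q : nat, forall k, Q%:Z <= k -> hcoef G (p i) k = 0.
      have [s [_ hs _]] := hcoef_seq G (p i); exists (\max_(k <- s) `|k|%N).+1 => k hk.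
      apply: hs; apply/negP => ks.
      have : (`|k| <= \max_(k <- s) `|k|)%N.
        exact: (@leq_bigmax_seq _ s predT (fun k : int => `|k|%N) k ks isT).
      by move: hk; set m := (\max_(k <- s) _)%N; lia.
    pose Q i := sval (cid (ex i)); exists (\max_i Q i) => Q' hQ' i.
    rewrite -/(p i); have [_ _ {1}->] := hcoefP G (p i).
    rewrite (@sum_allE _ _ [seq j%:Z | j <- iota 0 Q']).
    - by rewrite big_map -{1}[Q']subn0 -/(index_iota 0 Q') big_mkord.
    - by rewrite map_inj_uniq ?iota_uniq // => j j' [].
    move=> k /mapP hk; have [k0|k0] := ltP k 0.
      by have /from_degP h := valP (bco b i c : P); exact: h.
    have [kQ|kQ] := ltP k Q'; first by case: hk; exists `|k|%N; rewrite ?mem_iota; lia.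
    apply: (svalP (cid (ex i))); apply: le_trans kQ.
    by rewrite lez_nat (leq_trans _ hQ') // (leq_bigmax i).
  exists (maxn Qz Q) => Q'; rewrite geq_max => /andP[/IHz {1}-> /hQ {}hQ].
  under [in RHS]eq_bigr do under eq_bigr do rewrite termD.
  under [in RHS]eq_bigr do rewrite big_split; rewrite big_split; congr (_ + _).
  rewrite {1}(bE b c) tp_suml; apply: eq_bigr => i _.
  have hP q : hcoef G (nonneg_val G (bco b i c : P)) q%:Z \in from_deg G 0.
    exact: homog_nonneg (hcoef_homog G _ _).
  have -> : (bco b i c : P) = \sum_(q < Q') Nonneg (hP q).
    by apply/val_inj; rewrite raddf_sum; exact: hQ.
  rewrite rsc_sumr tp_suml; apply: eq_bigr => q _.
  have wP a : dv (dec q) a * hcoef G (nonneg_val G (bco b i c : P)) q%:Z \in G 0.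
    by have := homogM (dv_homog (dec q) a)
      (hcoef_homog G (nonneg_val G (bco b i c : P)) q%:Z); rewrite addNr.
  have -> : Nonneg (hP q) = \sum_a ud q a * inc (Deg0 (wP a)).
    apply/val_inj; rewrite raddf_sum /= -[LHS]mul1r -(du_dv (dec q)) mulr_suml.
    by apply: eq_bigr => a _; rewrite mulrA.
  rewrite rsc_sumr tp_suml; apply: eq_bigr => a _.
  by rewrite -rscA -rrestr_rsc tp_rscl coefE mulrA -rmorphM.
move=> x0; have [Q /(_ _ (leqnn Q)) ->] := rec; rewrite big1 // => i _; rewrite big1 // => q _.
by rewrite /term big1 // => a _; rewrite x0 mulr0 tp0r.
Qed.

(** 1 - [shift] is injective: for a fixed element the coefficients in degrees q, q - 1, q - 2, ...
    agree, and those in negative degrees vanish. *)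
Lemma shift_fix (dec : forall n, unit_dec G n) x : shift x = x -> x = 0.
Proof.
move=> fx; apply: coef_inj => // i q.
have h (n : nat) : coef i q x = coef i (q - n%:Z) x.
  elim: n => [|n ->]; first by rewrite subr0.
  by rewrite -{1}fx coef_shift -addrA -opprD -PoszD addn1.
by rewrite (h `|q|.+1); apply: coef_neg; lia.
Qed.
End Module.
End Resolution.
Arguments proj {R G N}.
Arguments shift {R G} dc {N}.
Arguments blift {R G N} b.

Lemma ext_mapB (K S : pzRingType) (f : {rmorphism K -> S}) (M N : rmodType K)
  (g : {linear M -> N}) x y : ext_map f g (x - y) = ext_map f g x - ext_map f g y.
Proof. exact: (linearB (ext_map f g)). Qed.

(** * Contracting the Laurent complex by means of the resolution *)

Section Telescope.
Variables (R : pzRingType) (G : zgrading R).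
Local Notation P := (nonneg G).
Local Notation L := (laurent G).
Local Notation toL := (@to_laurent R G).
Local Notation R0 := (deg0 G).
Local Notation inc := (deg0_nonneg G).
Local Notation ext0 := (ext_map (novikov0 G)).
Local Notation resm g := (rrestr_map inc g : {linear rrestr inc _ -> rrestr inc _}).
Variable dc : unit_dec G 1.

Lemma shift_natural (N N' : rmodType P) (g : {linear N -> N'}) x :
  shift dc (ext0 (resm g) x) = ext0 (resm g) (shift dc x).
Proof.
move: x; apply: (@ext_eq _ _ _ _ _ (shift dc \o ext0 (resm g))
  (ext0 (resm g) \o shift dc)) => c x /=.
transitivity (shift dc (tp (novikov0 G) (g c : rrestr inc N') x)).
  by congr (shift dc _); exact: ext_map_tp.
rewrite (shiftE dc (g c)) (shiftE dc c) [RHS](linear_sum (ext0 (resm g))).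
apply: eq_bigr => a _; etransitivity; last exact/esym/ext_map_tp.
by congr tp; exact: (esym (lin_rsc g c _)).
Qed.

Lemma proj_natural (N N' : rmodType P) (g : {linear N -> N'}) x :
  proj (ext0 (resm g) x) = ext_map (novikov G) g (proj x).
Proof.
move: x; apply: (@ext_eq _ _ _ _ _ (proj \o ext0 (resm g))
  (ext_map (novikov G) g \o @proj _ G N)) => c x /=.
transitivity (proj (tp (novikov0 G) (g c : rrestr inc N') x)).
  by congr (proj _); exact: ext_map_tp.
rewrite (projE (g c)); transitivity (ext_map (novikov G) g (tp (novikov G) c x)).
  exact/esym/ext_map_tp.
by congr (ext_map _ _); exact/esym/projE.
Qed.

(** In a basis of [V] the entries of i [shift] p are sums of elements of R_0 times v_a, which has
    degree -1; so the geometric series inverts 1 minus this map. *)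
Lemma shift_inv (N : rmodType P) (V : rmodType R0) (bV : basis V)
    (p : {linear V -> rrestr inc N}) (i : {linear rrestr inc N -> V}) :
  {w : {linear ext_mod (novikov0 G) V -> ext_mod (novikov0 G) V} |
    (forall y, w (y - ext0 i (shift dc (ext0 p y))) = y) /\
    (forall y, w y - ext0 i (shift dc (ext0 p (w y))) = y)}.
Proof.
set Y := ext_mod (novikov0 G) V.
pose u : {linear Y -> Y} := ext0 i \o shift dc \o ext0 p.
pose bY : basis Y := ext_basis (novikov0 G) bV.
pose E := mx_of bY bY u.
have hE : mlle (-1) E.
  move=> k l; rewrite mxE ext_bv /u /= ext_map_tp shiftE
    (linear_sum (ext0 i)) (linear_sum (bco bY k)).
  apply: lle_sum => a; rewrite /= ext_map_tp ext_bco mulr1 -[-1]add0r.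
  by apply: lleM; apply: lle_to; [exact: valP | exact: dv_homog].
have [B [EB BE _]] := cid (mlle_inv hE).
pose g : {linear Y -> Y} := idfun \- u.
have gE : mx_of bY bY g = 1%:M - E.
  by apply/matrixP => k l; rewrite !mxE -[g _]/(bv bY l - u (bv bY l)) linearB bK.
exists (@lin_of _ _ _ bY bY B); split=> y.
- apply: (@mx_of_inj _ _ _ bY bY (lin_of B \o g) idfun).
  by rewrite (mx_of_comp bY bY bY) lin_ofK gE BE mx_of1.
- apply: (@mx_of_inj _ _ _ bY bY (g \o @lin_of _ _ _ bY bY B) idfun).
  by rewrite (mx_of_comp bY bY bY) lin_ofK gE EB mx_of1.
Qed.

Section Complex.
Variables (sG : strongly_graded G) (C : chain_complex P) (b : forall n, basis (C n)).
Local Notation RC := (restrict_scalars inc C).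
Local Notation X n := (ext_mod (novikov0 G) (RC n)).
Local Notation M n := (ext_mod (novikov G) (C n)).
Local Notation dX n := (ext0 (bd RC n)).
Local Notation dM n := (ext_map (novikov G) (bd C n)).

(** On a basis vector e both composites are lifts of d e (x) 1, so [blift_tp] supplies the value of
    [om], which extends linearly. *)
Lemma lift_defect n : {om : {linear M (n + 1) -> X n} | forall z,
  dX n (blift (b (n + 1)) z) = blift (b n) (dM n z) + (om z - shift dc (om z))}.
Proof.
have y j := cid (@blift_tp _ _ dc _ (b n) (bd C n (bv (b (n + 1)) j))).
have [om omE] := @basis_fun _ _ _ (ext_basis (novikov G) (b (n + 1))) (fun j => sval (y j)).
have omE' j : om (tp (novikov G) (bv (b (n + 1)) j) 1) = sval (y j) := omE j.
exists om => z.
pose l : {linear M (n + 1) -> X n} := dX n \o blift (b (n + 1)).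
pose r : {linear M (n + 1) -> X n} := (blift (b n) \o dM n) \+ (om \- (shift dc \o om)).
move: z; apply: (@basis_ext _ _ _ (ext_basis (novikov G) (b (n + 1))) l r) => j.
rewrite /l /r /= omE' bliftE !ext_map_tp -(svalP (y j)).
by rewrite addrCA subrr addr0.
Qed.

Variables (D : chain_complex R0) (bD : forall n, basis (D n)).
Local Notation dY n := (ext0 (bd D n)).
Variables (i : forall n, {linear RC n -> D n}) (r : forall n, {linear D n -> RC n}).
Hypotheses (i_chain : chain_map i) (r_chain : chain_map r).
Variable H : forall n, {linear RC n -> RC (n + 1)}.
Hypothesis H_homotopy : forall n x,
  r (n + 1) (i (n + 1) x) - x = bd RC (n + 1) (H (n + 1) x) + H n (bd RC n x).

(* With x the lift of z, y its defect (a cycle) and w the inverse of 1 - i sigma r,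
   the element g = r w (i x - i sigma H y) - H y satisfies d g = y. So x' = x - (1 - sigma) g
   is a cycle over z; and as i x' = (1 - i sigma r) y0 with y0 = w i x', the homotopies
   between r i and 1 make z = proj x' a boundary. *)
Lemma novikov_cycle n : exists k : {linear M (n + 1 + 1) -> M (n + 1 + 1 + 1)},
  forall z, dM (n + 1) z = 0 -> dM (n + 1 + 1) (k z) = z.
Proof.
have I m (x : X (m + 1)) : ext0 (i m) (dX m x) = dY m (ext0 (i (m + 1)) x).
  move: x; apply: (@ext_eq _ _ _ _ _ (ext0 (i m) \o dX m) (dY m \o ext0 (i (m + 1)))) => c x.
  by rewrite /= !ext_map_tp i_chain.
have Rr m x : ext0 (r m) (dY m x) = dX m (ext0 (r (m + 1)) x).
  move: x; apply: (@ext_eq _ _ _ _ _ (ext0 (r m) \o dY m) (dX m \o ext0 (r (m + 1)))) => c x.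
  by rewrite /= !ext_map_tp r_chain.
have RI m (x : X (m + 1)) : ext0 (r (m + 1)) (ext0 (i (m + 1)) x) =
    x + (dX (m + 1) (ext0 (H (m + 1)) x) + ext0 (H m) (dX m x)).
  move: x; apply: (@ext_eq _ _ _ _ _ (ext0 (r (m + 1)) \o ext0 (i (m + 1)))
    (idfun \+ ((dX (m + 1) \o ext0 (H (m + 1))) \+ (ext0 (H m) \o dX m)))) => c x.
  by rewrite /= !ext_map_tp -!tpDl -H_homotopy [c + _]addrC subrK.
have S m (x : X (m + 1)) : shift dc (dX m x) = dX m (shift dc x).
  exact: shift_natural.
have Pd m (x : X (m + 1)) : proj (dX m x) = dM m (proj x).
  exact: proj_natural.
have dXK m (x : X (m + 1 + 1)) : dX m (dX (m + 1) x) = 0.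
  exact: (@bdK _ (extend_scalars (novikov0 G) RC) m x).
have dYK m x : dY m (dY (m + 1) x) = 0.
  exact: (@bdK _ (extend_scalars (novikov0 G) D) m x).
have w_ m := shift_inv (bD m) (r m) (i m).
pose w m := sval (w_ m).
have wl m y : w m (y - ext0 (i m) (shift dc (ext0 (r m) y))) = y.
  by have [h _] := svalP (w_ m); exact: h.
have wr m y : w m y - ext0 (i m) (shift dc (ext0 (r m) (w m y))) = y.
  by have [_ h] := svalP (w_ m); exact: h.
(* [w] commutes with the differentials because its inverse 1 - i [shift] r does. *)
have wd m y : dY m (w (m + 1) y) = w m (dY m y).
  rewrite -{2}(wr (m + 1) y) ext_mapB -I -S -Rr.
  by rewrite wl.
clearbody w.
pose om := sval (lift_defect (n + 1)).
have omE z := svalP (lift_defect (n + 1)) z.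
pose g : {linear M (n + 1 + 1) -> X (n + 1 + 1)} :=
  (ext0 (r (n + 1 + 1)) \o w (n + 1 + 1) \o
     ((ext0 (i (n + 1 + 1)) \o blift (b (n + 1 + 1))) \-
      (ext0 (i (n + 1 + 1)) \o shift dc \o ext0 (H (n + 1)) \o om)))
  \- (ext0 (H (n + 1)) \o om).
pose x' : {linear M (n + 1 + 1) -> X (n + 1 + 1)} :=
  blift (b (n + 1 + 1)) \- (g \- (shift dc \o g)).
pose y0 : {linear M (n + 1 + 1) -> ext_mod (novikov0 G) (D (n + 1 + 1))} :=
  w (n + 1 + 1) \o ext0 (i (n + 1 + 1)) \o x'.
pose k : {linear M (n + 1 + 1) -> M (n + 1 + 1 + 1)} :=
  \- ((proj \o ext0 (H (n + 1 + 1)) \o shift dc \o ext0 (r (n + 1 + 1)) \o y0)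
     \+ (proj \o ext0 (H (n + 1 + 1)) \o x')).
exists k => z dz.
set x := blift (b (n + 1 + 1)) z; set y := om z.
have dxE : dX (n + 1) x = y - shift dc y.
  by rewrite omE dz (linear0 (blift _)) add0r.
(* (1 - [shift]) d y = d d x = 0, and 1 - [shift] is injective. *)
have dy : dX n y = 0.
  apply: (@shift_fix _ _ dc _ (b n) (unit_decP sG)).
  apply/esym/eqP; rewrite -subr_eq0 S -ext_mapB -dxE; exact/eqP/dXK.
have dHy : dX (n + 1) (ext0 (H (n + 1)) y) = ext0 (r (n + 1)) (ext0 (i (n + 1)) y) - y.
  by rewrite RI dy ext_map0 addr0 [RHS]addrC addKr.
have gE : g z = ext0 (r (n + 1 + 1)) (w (n + 1 + 1) (ext0 (i (n + 1 + 1)) x -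
    ext0 (i (n + 1 + 1)) (shift dc (ext0 (H (n + 1)) y)))) - ext0 (H (n + 1)) y by [].
have x'E : x' z = x - (g z - shift dc (g z)) by [].
have y0E : y0 z = w (n + 1 + 1) (ext0 (i (n + 1 + 1)) (x' z)) by [].
have kE : k z = - (proj (ext0 (H (n + 1 + 1)) (shift dc (ext0 (r (n + 1 + 1)) (y0 z))))
    + proj (ext0 (H (n + 1 + 1)) (x' z))) by [].
have px : proj x = z := bliftK (b (n + 1 + 1)) z.
clearbody k; clearbody y0; clearbody x'; clearbody g y x.
(* With d H y = r i y - y, the argument of [w] has differential (1 - i [shift] r)(i y). So d g = r i
   y - (r i y - y) = y. *)
have dg : dX (n + 1) (g z) = y.
  rewrite gE ext_mapB -Rr wd ext_mapB -!I dxE -S dHy.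
  by rewrite (linearB (shift dc)) !ext_mapB opprB addrA subrK wl subKr.
have dx' : dX (n + 1) (x' z) = 0.
  by rewrite x'E ext_mapB ext_mapB -S dg dxE subrr.
have projB (c c' : X (n + 1 + 1)) : proj (c - c') = proj c - proj c' := linearB proj c c'.
have px' : proj (x' z) = z.
  by rewrite x'E !projB px proj_shift subrr subr0.
have dy0 : dY (n + 1) (y0 z) = 0 by rewrite y0E wd -I dx' ext_map0 (linear0 (w _)).
have iy0 : ext0 (i (n + 1 + 1)) (x' z) = y0 z -
  ext0 (i (n + 1 + 1)) (shift dc (ext0 (r (n + 1 + 1)) (y0 z))) by rewrite y0E wr.
have de : dX (n + 1) (shift dc (ext0 (r (n + 1 + 1)) (y0 z))) = 0.
  by rewrite -S -Rr dy0 ext_map0 linear0.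
set e := ext0 (r (n + 1 + 1)) (y0 z) in iy0 kE de.
have He : dX (n + 1 + 1) (ext0 (H (n + 1 + 1)) (shift dc e)) =
    ext0 (r (n + 1 + 1)) (ext0 (i (n + 1 + 1)) (shift dc e)) - shift dc e.
  by rewrite RI de ext_map0 addr0 [RHS]addrC addKr.
have Hx' : dX (n + 1 + 1) (ext0 (H (n + 1 + 1)) (x' z)) =
    (e - ext0 (r (n + 1 + 1)) (ext0 (i (n + 1 + 1)) (shift dc e))) - x' z.
  by rewrite -ext_mapB -iy0 RI dx' ext_map0 addr0 [RHS]addrC addKr.
rewrite kE; transitivity (- (dM (n + 1 + 1) (proj (ext0 (H (n + 1 + 1)) (shift dc e)))
    + dM (n + 1 + 1) (proj (ext0 (H (n + 1 + 1)) (x' z))))).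
  rewrite -ext_mapD; exact: (linearN (dM (n + 1 + 1))).
(* The two terms r i [shift] e cancel, and so do e and [shift] e under [proj]; what remains is the
   projection of x', which is z. *)
rewrite -!Pd He Hx' !projB px' proj_shift.
by rewrite addrA subrKA subrr sub0r opprK.
Qed.

End Complex.
End Telescope.

Lemma finitely_dominated_novikov (R : pzRingType) (G : zgrading R)
    (C : chain_complex (nonneg G)) (b : forall n, basis (C n)) : strongly_graded G ->
  finitely_dominated (restrict_scalars (deg0_nonneg G) C) ->
  contractible (extend_scalars (novikov G) C).
Proof.
move=> sG [D [_ freeD [i [r [hi hr [H HE]]]]]].
apply: contractible_cycles => n.
pose bD m := sval (cid (fg_free_basis (freeD m))).
exact: (novikov_cycle (unit_decP sG 1) sG b bD hi hr HE).
Qed.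

(** * The circle of implications, through the universal properties of both localisations *)

Theorem theorem10p6 (R : pzRingType) (G : zgrading R)
    (strongG : strongly_graded G)
    (C : chain_complex (nonneg G)) (bddC : bounded_complex C)
    (freeC : forall n : int, fg_free (C n))
    (LP : pzRingType) (iotaP : {rmorphism nonneg G -> LP})
    (locP : universal_localisation iotaP (@omega_nonneg R G))
    (LR : pzRingType) (iotaR : {rmorphism R -> LR})
    (locR : universal_localisation iotaR (@omega_full R G)) :
  let fin_dom := finitely_dominated (restrict_scalars (deg0_nonneg G) C) in
  let contractP := contractible (extend_scalars iotaP C) in
  let contractR :=
    contractible (extend_scalars (iotaR \o nonneg_val G) C) in
  (fin_dom <-> contractP) /\ (fin_dom <-> contractR).
Proof.
move=> fin_dom contractP contractR.
have [N hN] := bddC.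
have [b bN] : exists b : forall n, basis (C n), forall n, N%:Z < `|n| -> rk (b n) = 0%N.
  have ex n : exists b : basis (C n), N%:Z < `|n| -> rk b = 0%N.
    have [nN|nN] := ltP N%:Z `|n|; first by exists (basis0 (hN n nN)).
    by have [b _] := fg_free_basis (freeC n); exists b.
  by exists (fun n => sval (cid (ex n))) => n; case: cid.
have [invP univP] := locP; have [invR univR] := locR.
have h1 : fin_dom -> contractP.
  move=> /(finitely_dominated_novikov b strongG).
  exact: (contractible_omega_nonneg bN invP).
have h2 : contractP -> contractR.
  have [h [hE _]] := univP _ _ (inverts_omega_nonneg strongG invR).
  exact: (contractible_transfer b hE).
have h3 : contractR -> fin_dom.
  have [h [hE _]] := univR _ _ (@inverts_omega_full R G).
  move=> cR; apply: (novikov_finitely_dominated strongG bN).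
  by apply: (contractible_transfer b (h := h)) cR => x; exact: hE.
by split; split=> // *; [apply/h3/h2 | apply/h2/h1].
Qed.
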